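(* Let $\Omega\subset\mathbb{C}^n$ be a bounded domain and let $\mathcal R$ and $\mathcal R'$ be quasi-free Hilbert modules of finite rank $m$ over $A(\Omega)$, with generating sets $\{f_1,\dots,f_m\}$ and $\{g_1,\dots,g_m\}$ respectively. If $\mathcal R$ and $\mathcal R'$ are unitarily equivalent, then the modulus $\mu(\mathcal R,\mathcal R')$ is the absolute value of a function $\Psi\in \mathrm{Hol}_m(\Omega)$, i.e. $\mu(\mathcal R,\mathcal R')(z)=|\Psi(z)|=(\Psi(z)^*\Psi(z))^{1/2}$ for all $z\in\Omega$.
   Context: $A(\Omega)$ is the closure, in the supremum norm on $\Omega$, of the set of functions holomorphic on some neighbourhood of $\overline\Omega$. $\ell^2_m$ denotes the $m$-dimensional Hilbert space, and $\mathrm{Hol}_m(\Omega)$ the space of holomorphic functions $\Omega\to\mathcal L(\ell^2_m)$ (i.e. holomorphic $m\times m$ matrix-valued functions). A quasi-free Hilbert module of rank $m$ over $A(\Omega)$ is a Hilbert space $\mathcal R$ obtained as the completion of the algebraic tensor product $A(\Omega)\otimes\ell^2_m$ (regarded as $\ell^2_m$-valued holomorphic functions on $\Omega$) with respect to an inner product such that: (1) for each $z\in\Omega$ the evaluation map $\mathrm{eval}_z:A(\Omega)\otimes\ell^2_m\to\ell^2_m$ is bounded, with norm locally uniformly bounded in $z$; (2) $\|\varphi F\|_{\mathcal R}\le\|\varphi\|_{A(\Omega)}\|F\|_{\mathcal R}$ for $\varphi\in A(\Omega)$, $F\in A(\Omega)\otimes\ell^2_m$; (3) if $(F_i)$ in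 $A(\Omega)\otimes\ell^2_m$ is Cauchy in the $\mathcal R$-norm, then $\mathrm{eval}_z(F_i)\to0$ for all $z\in\Omega$ iff $\|F_i\|_{\mathcal R}\to0$. Thus elements of $\mathcal R$ are $\ell^2_m$-valued holomorphic functions on $\Omega$ and $\mathcal R$ is a Hilbert module over $A(\Omega)$ under multiplication. For $z\in\Omega$, $\mathbb C_z$ is $\mathbb C$ with module action $\varphi\cdot\lambda=\varphi(z)\lambda$; the localization $\mathcal R\otimes_{A(\Omega)}\mathbb C_z$ is identified with the quotient $\mathcal R/\mathcal R_z$, where $\mathcal R_z$ is the closure of $A(\Omega)_z\mathcal R$ and $A(\Omega)_z=\{\varphi\in A(\Omega):\varphi(z)=0\}$; $h\otimes 1_z$ denotes the class of $h$. It is an $m$-dimensional Hilbert space. A generating set of $\mathcal R$ is a set $\{f_1,\dots,f_m\}\subset\mathcal R$ whose $A(\Omega)$-multiples span a dense subspace of $\mathcal R$ and such that $\{f_i\otimes1_z\}$ is a basis of $\mathcal R\otimes_{A(\Omega)}\mathbb C_z$ for each $z$ (then $\{f_i(z)\}$ is a basis of $\ell^2_m$). Given generating sets $\{f_i\}$ of $\mathcal R$ and $\{g_i\}$ of $\mathcal R'$, the closure $\Delta$ in $\mathcal R\oplus\mathcal R'$ of the span of $\{\varphi f_i\oplus\varphi g_i:\varphi\in A(\Omega),1\le i\le m\}$ is the graph of a closed, densely defined, injective module transformation $\delta=\delta(\mathcal R,\mathcal R')$ with dense range (sending $\varphi f_i$ to $\varphi g_i$), and for each $z$ it induces a well-defined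 invertible linear map $\delta\otimes 1_z:\mathcal R\otimes_{A(\Omega)}\mathbb C_z\to\mathcal R'\otimes_{A(\Omega)}\mathbb C_z$, $h\otimes1_z\mapsto \delta h\otimes 1_z$. The modulus is $\mu(\mathcal R,\mathcal R')(z)=((\delta\otimes1_z)^*(\delta\otimes1_z))^{1/2}$, a positive invertible operator on the $m$-dimensional space $\mathcal R\otimes_{A(\Omega)}\mathbb C_z$, regarded as an $m\times m$ matrix. $\mathcal R$ and $\mathcal R'$ are unitarily equivalent if there is a unitary $U:\mathcal R\to\mathcal R'$ with $U(\varphi h)=\varphi U(h)$ for all $\varphi\in A(\Omega)$, $h\in\mathcal R$.
   Formalization: The adjoint in |Ψ(z)| = (Ψ(z)*Ψ(z))^{1/2} is taken for the Hilbert structure of R⊗C_z, with Ψ(z) and the modulus written in the basis {f_i⊗1_z}, not for the standard inner product of ℓ²_m; with the standard adjoint the claim fails for m ≥ 2. *)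

(* Defs.v *)
From mathcomp Require Import all_boot all_algebra.
From mathcomp Require Import all_classical all_reals all_analysis.
From mathcomp Require Import complex.
From Stdlib Require Import ClassicalEpsilon.
Import GRing.Theory Num.Theory.

Set Implicit Arguments.
Unset Strict Implicit.
Unset Printing Implicit Defensive.

Local Open Scope ring_scope.
Local Open Scope classical_set_scope.

Section QuasiFree.
Variable R : realType.
Local Notation C := R[i].

Definition Cn (n : nat) : normedModType C := 'rV[C]_n.
Definition CC : normedModType C := C^o.

Variables n m : nat.
Local Notation Pt := (Cn n).
(* l^2_m-valued functions on C^n (elements of a module vanish off Omega) *)
Definition Fn := Pt -> 'cV[C]_m.

Variable Om : set Pt.

Definition bounded_domain := [/\ Om !=set0, open Om, connected Om & bounded_set Om].

(* A(Omega): sup-norm (on Omega) closure of functions holomorphic (complex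
   Frechet differentiable) on some open neighbourhood of the closure of Omega *)
Definition A_alg (phi : Pt -> C) : Prop :=
  forall eps : C, 0 < eps ->
    exists (U : set Pt) (g : Pt -> CC),
      [/\ open U, closure Om `<=` U, (forall z, U z -> differentiable g z)
        & forall z, Om z -> `|phi z - g z| < eps].

Definition mulA (phi : Pt -> C) (F : Fn) : Fn := fun z => phi z *: F z.

(* algebraic tensor product A(Omega) (x) l^2_m, as functions on Omega *)
Definition alg_tensor (F : Fn) : Prop :=
  exists k (phi : 'I_k -> Pt -> C) (v : 'I_k -> 'cV[C]_m),
    (forall i, A_alg (phi i)) /\
    forall z, (Om z -> F z = \sum_(i < k) phi i z *: v i) /\ (~ Om z -> F z = 0).

Definition l2sq (v : 'cV[C]_m) : C := \sum_(i < m) `|v i 0| ^+ 2.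

(* A quasi-free Hilbert module of rank m over A(Omega), realised (as in the
   paper) as a Hilbert space H of l^2_m-valued functions on Omega, with inner
   product ip (linear in the first variable). *)
Definition quasi_free (H : set Fn) (ip : Fn -> Fn -> C) : Prop :=
      (H 0 /\ (forall (a : C) F G, H F -> H G -> H (a *: F + G))) /\
      (forall F z, H F -> ~ Om z -> F z = 0) /\
      (forall (a : C) F G K, H F -> H G -> H K -> ip (a *: F + G) K = a * ip F K + ip G K)
      /\ (forall F G, H F -> H G -> ip G F = (ip F G)^* )
      /\ (forall F, H F -> 0 <= ip F F)
      /\ (forall F, H F -> ip F F = 0 -> F = 0) /\
      (forall u : nat -> Fn, (forall k, H (u k)) ->
         (forall eps : C, 0 < eps -> exists N, forall p q, (N <= p)%N -> (N <= q)%N ->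
              ip (u p - u q) (u p - u q) < eps) ->
         exists L, H L /\ forall eps : C, 0 < eps -> exists N, forall p, (N <= p)%N ->
              ip (u p - L) (u p - L) < eps) /\
      (* H is the completion of A(Omega) (x) l^2_m *)
      (forall F, alg_tensor F -> H F) /\
      (forall F, H F -> forall eps : C, 0 < eps ->
         exists G, alg_tensor G /\ ip (F - G) (F - G) < eps) /\
      (forall z, Om z -> exists M : C, \forall w \near z,
         forall F, H F -> l2sq (F w) <= M * ip F F) /\
      (forall phi F, A_alg phi -> H F ->
         H (mulA phi F) /\
         forall M : C, 0 <= M -> (forall z, Om z -> `|phi z| <= M) ->
           ip (mulA phi F) (mulA phi F) <= M ^+ 2 * ip F F).

Definition Rz (H : set Fn) (ip : Fn -> Fn -> C) (z : Pt) (F : Fn) : Prop :=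
  H F /\ forall eps : C, 0 < eps ->
    exists k (phi : 'I_k -> Pt -> C) (h : 'I_k -> Fn),
      (forall j, [/\ A_alg (phi j), phi j z = 0 & H (h j)]) /\
      ip (F - \sum_(j < k) mulA (phi j) (h j)) (F - \sum_(j < k) mulA (phi j) (h j)) < eps.

Definition comb (f : 'I_m -> Fn) (c : 'cV[C]_m) : Fn := \sum_(i < m) c i 0 *: f i.

Definition generating (H : set Fn) (ip : Fn -> Fn -> C) (f : 'I_m -> Fn) : Prop :=
  [/\ forall i, H (f i),
      (forall F, H F -> forall eps : C, 0 < eps ->
         exists k (phi : 'I_k -> Pt -> C) (idx : 'I_k -> 'I_m),
           (forall j, A_alg (phi j)) /\
           ip (F - \sum_(j < k) mulA (phi j) (f (idx j)))
              (F - \sum_(j < k) mulA (phi j) (f (idx j))) < eps)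
    & (* {f_i (x) 1_z} is a basis of R/R_z for every z in Omega *)
      forall z, Om z ->
        (forall F, H F -> exists c, Rz H ip z (F - comb f c)) /\
        (forall c, Rz H ip z (comb f c) -> c = 0)].

Definition perp_part (H : set Fn) (ip : Fn -> Fn -> C) (z : Pt) (F P : Fn) : Prop :=
  [/\ H P, Rz H ip z (F - P) & forall r, Rz H ip z r -> ip P r = 0].

Definition qproj (H : set Fn) (ip : Fn -> Fn -> C) (z : Pt) (F : Fn) : Fn :=
  epsilon (inhabits (0 : Fn)) (perp_part H ip z F).

(* inner product of the quotient Hilbert space R/R_z = R (x)_{A(Omega)} C_z *)
Definition qip (H : set Fn) (ip : Fn -> Fn -> C) (z : Pt) (F G : Fn) : C := ip (qproj H ip z F) (qproj H ip z G).

Definition cip (H : set Fn) (ip : Fn -> Fn -> C) (f : 'I_m -> Fn) (z : Pt) (c d : 'cV[C]_m) : C :=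
  qip H ip z (comb f c) (comb f d).

(* graph Delta of delta(R,R'): closure in R (+) R' of span{phi f_i (+) phi g_i} *)
Definition Delta (H : set Fn) (ip : Fn -> Fn -> C) (H' : set Fn) (ip' : Fn -> Fn -> C) (f g : 'I_m -> Fn) (h k : Fn) : Prop :=
  [/\ H h, H' k &
    forall eps : C, 0 < eps ->
      exists kk (phi : 'I_kk -> Pt -> C) (idx : 'I_kk -> 'I_m),
        (forall j, A_alg (phi j)) /\
        ip (h - \sum_(j < kk) mulA (phi j) (f (idx j)))
           (h - \sum_(j < kk) mulA (phi j) (f (idx j)))
        + ip' (k - \sum_(j < kk) mulA (phi j) (g (idx j)))
              (k - \sum_(j < kk) mulA (phi j) (g (idx j))) < eps].

(* D is the matrix (bases {f_i (x) 1_z}, {g_i (x) 1_z}) of delta (x) 1_z :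
   h (x) 1_z |-> delta h (x) 1_z *)
Definition loc_delta (H : set Fn) (ip : Fn -> Fn -> C) (H' : set Fn) (ip' : Fn -> Fn -> C) (f g : 'I_m -> Fn) (z : Pt) (D : 'M[C]_m) : Prop :=
  forall h k, Delta H ip H' ip' f g h k ->
    forall c, Rz H ip z (h - comb f c) -> Rz H' ip' z (k - comb g (D *m c)).

Definition is_adjoint (ip1 ip2 : 'cV[C]_m -> 'cV[C]_m -> C) (A B : 'M[C]_m) :=
  forall x y, ip2 (A *m x) y = ip1 x (B *m y).

Definition is_positive (ip1 : 'cV[C]_m -> 'cV[C]_m -> C) (P : 'M[C]_m) :=
  (forall x y, ip1 (P *m x) y = ip1 x (P *m y)) /\ (forall x, 0 <= ip1 (P *m x) x).

Definition is_abs (ip1 ip2 : 'cV[C]_m -> 'cV[C]_m -> C) (A S : 'M[C]_m) :=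
  exists B, [/\ is_adjoint ip1 ip2 A B, is_positive ip1 S & S *m S = B *m A].

(* S is the modulus mu(R,R')(z) (in the coordinates of the basis {f_i (x) 1_z}) *)
Definition is_modulus (H : set Fn) (ip : Fn -> Fn -> C) (H' : set Fn) (ip' : Fn -> Fn -> C) (f g : 'I_m -> Fn) (z : Pt) (S : 'M[C]_m) : Prop :=
  exists D, loc_delta H ip H' ip' f g z D /\
    is_abs (cip H ip f z) (cip H' ip' g z) D S.

Definition unitarily_equivalent (H : set Fn) (ip : Fn -> Fn -> C) (H' : set Fn) (ip' : Fn -> Fn -> C) : Prop :=
  exists U : Fn -> Fn,
    [/\ forall F, H F -> H' (U F),
        forall F', H' F' -> exists F, H F /\ U F = F',
        forall (a : C) F G, H F -> H G -> U (a *: F + G) = a *: U F + U G,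
        forall F G, H F -> H G -> ip' (U F) (U G) = ip F G
      & forall phi F, A_alg phi -> H F -> U (mulA phi F) = mulA phi (U F)].

Definition hol_matrix (Psi : Pt -> 'M[C]_m) : Prop :=
  forall i j z, Om z -> differentiable (fun w => (Psi w i j : CC)) z.

End QuasiFree.

(* Main.v *)
Require Import Defs.
From HB Require Import structures.
From mathcomp Require Import all_boot all_order all_algebra.
From mathcomp Require Import all_classical all_reals all_analysis.
From mathcomp Require Import complex.
From mathcomp Require Import ring lra.
From Stdlib Require Import ClassicalEpsilon.
Import Order.TTheory GRing.Theory Num.Theory.
Import numFieldNormedType.Exports.
Import Normc.

(* Let U : R -> R' be the unitary and G_i = U^-1 g_i. In the bases {f_i (x) 1_z}
   and {g_i (x) 1_z}, delta (x) 1_z is the identity matrix, while U^-1 (x) 1_z is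
   the matrix Psi(z) determined by G_j = sum_i Psi_ij(z) f_i modulo R_z. As
   U^-1 (x) 1_z is isometric, the square of the modulus is Psi(z)^* Psi(z).
   Elements of R_z vanish at z, so Psi(z) = F(z)^-1 G(z), where F(z) and G(z)
   have columns f_j(z) and G_j(z), and it remains to see that the elements of R
   are holomorphic. They are locally uniform limits of holomorphic functions, so
   this is Weierstrass's theorem. It only needs the Schwarz-type bound
   |phi(a) - phi(0)| <= C sup|phi| |a|, which is obtained from Goursat's
   bisection argument applied to the difference quotients of phi at 0 and at a.
   Boundary integrals over squares are replaced by dyadic midpoint sums: these
   are exact on affine functions and additive under bisection, which is all the
   argument uses, and they tend to 0 where the integral would vanish. *)

Set Implicit Arguments.
Unset Strict Implicit.
Unset Printing Implicit Defensive.

Local Open Scope ring_scope.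
Local Open Scope classical_set_scope.
Local Notation mulA := Defs.mulA.

(** * Boundary sums over squares *)

Section Modulus.
Variable R : realType.
Implicit Types z w : R[i].

Lemma normc_norm z : `|z| = ((normc z)%:C)%C.
Proof. by []. Qed.

Lemma normc_ge0 z : 0 <= normc z.
Proof. by case: z => a b; rewrite sqrtr_ge0. Qed.

Lemma ler_normcD z w : normc (z + w) <= normc z + normc w.
Proof. exact: (@le_normcD R). Qed.

Lemma normc_opp z : normc (- z) = normc z.
Proof. exact: (@normcN R). Qed.

Lemma normc_real (x : R) : normc (x%:C)%C = `|x|.
Proof. by rewrite /= expr0n addr0 sqrtr_sqr. Qed.

Lemma normc_i (x : R) : normc ('i * x%:C)%C = `|x|.
Proof.
by rewrite normcM normc_real /= expr0n expr1n add0r sqrtr1 mul1r.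
Qed.

Lemma normc_Re z : `|complex.Re z| <= normc z.
Proof. by case: z => a b /=; rewrite -sqrtr_sqr ler_sqrt ?addr_ge0 ?sqr_ge0// lerDl sqr_ge0. Qed.

Lemma normc_Im z : `|complex.Im z| <= normc z.
Proof. by case: z => a b /=; rewrite -sqrtr_sqr ler_sqrt ?addr_ge0 ?sqr_ge0// lerDr sqr_ge0. Qed.

Lemma normc_ReIm z : normc z <= `|complex.Re z| + `|complex.Im z|.
Proof.
rewrite [X in normc X]complexE; apply: le_trans (ler_normcD _ _) _.
by rewrite normc_real normc_i.
Qed.

Lemma normc_gt0 z : (0 < normc z) = (z != 0).
Proof.
rewrite lt_def normc_ge0 andbT; congr (~~ _).
by apply/eqP/eqP => [/eq0_normc//|->]; exact: normc0.
Qed.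

Lemma two_neq0 : 2 != 0 :> R[i].
Proof. by rewrite pnatr_eq0. Qed.

(** The order of [R[i]] compares only numbers with equal imaginary parts, so a positive element is
    real. This turns the complex epsilons of the definitions into real ones. *)
Lemma posC (e : R[i]) : 0 < e -> e = ((complex.Re e)%:C)%C /\ 0 < complex.Re e.
Proof. by case: e => a b; rewrite ltcE /= => /andP[/eqP -> ->]. Qed.

End Modulus.

Section MidpointSums.
Variable R : realType.
Local Notation C := R[i].
Local Hint Resolve two_neq0 : core.
Implicit Types (f g : C -> C) (z d c : C).

(* The midpoint rule with 2 ^ N nodes for the integral of f along the segment
   from z to z + d; it is exact on affine functions and exactly additive under
   bisection. *)
Fixpoint segsum (N : nat) f z d : C :=
  if N is N'.+1 then segsum N' f z (d / 2) + segsum N' f (z + d / 2) (d / 2)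
  else f (z + d / 2) * d.

Lemma segsumS N f z d :
  segsum N.+1 f z d = segsum N f z (d / 2) + segsum N f (z + d / 2) (d / 2).
Proof. by []. Qed.

Lemma segsumD N f g z d :
  segsum N (fun x => f x + g x) z d = segsum N f z d + segsum N g z d.
Proof. by elim: N z d => [|N IH] z d /=; rewrite ?mulrDl// !IH addrACA. Qed.

Lemma segsumM N k f z d : segsum N (fun x => k * f x) z d = k * segsum N f z d.
Proof. by elim: N z d => [|N IH] z d /=; rewrite ?mulrA// !IH mulrDr. Qed.

(** The midpoints of the two halves average to the midpoint of the segment, so refining does not
    change the sum. *)
Lemma segsum_affine N (a b c z d : C) :
  segsum N (fun x => a + b * (x - c)) z d = a * d + b * (z + d / 2 - c) * d.
Proof.
elim: N z d => [|N IH] z d /=; first by rewrite mulrDl.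
by rewrite !IH; field.
Qed.

(** Every node lies on the segment, and the weights are [2 ^ N] equal fractions of [d]. *)
Lemma segsum_le N f z d (B : R) :
  (forall t : R, 0 <= t <= 1 -> normc (f (z + (t%:C)%C * d)) <= B) ->
  normc (segsum N f z d) <= B * normc d.
Proof.
have h2 : ((2^-1)%:C)%C = 2^-1 :> C by rewrite fmorphV rmorph_nat.
elim: N z d => [|N IH] z d fB.
  rewrite [segsum _ _ _ _]/= normcM ler_wpM2r ?normc_ge0//.
  have /fB : 0 <= (2^-1 : R) <= 1 by lra.
  by rewrite h2 mulrC.
have -> : B * normc d = B * normc (d / 2) + B * normc (d / 2).
  by rewrite normcM -h2 normc_real ger0_norm; [field|lra].
rewrite segsumS; apply: le_trans (ler_normcD _ _) _; apply: lerD; apply: IH => t t01.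
  have -> : (t%:C)%C * (d / 2) = ((t / 2)%:C)%C * d by rewrite rmorphM/= h2; field.
  apply: fB; lra.
have -> : z + d / 2 + (t%:C)%C * (d / 2) = z + ((2^-1 + t / 2)%:C)%C * d.
  by rewrite rmorphD rmorphM/= h2; field.
apply: fB; lra.
Qed.

Local Notation "'I" := ('i%C : C).

(** Counterclockwise boundary sum for the square with lower left corner [z] and side [s]. The top
    and left sides are summed in the positive axis directions and subtracted. *)
Definition sqsum N f z (s : R) : C :=
  let d := (s%:C)%C in
  segsum N f z d + segsum N f (z + d) ('I * d)
  - segsum N f (z + 'I * d) d - segsum N f z ('I * d).

(** Each inner edge of the four quarters is run through once in each direction with the same nodes,
    so it cancels; each outer side is the sum of its halves, one refinement level lower. *)
Lemma sqsumS N f z s : sqsum N.+1 f z s =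
  sqsum N f z (s / 2) + sqsum N f (z + ((s / 2)%:C)%C) (s / 2)
  + sqsum N f (z + 'I * ((s / 2)%:C)%C) (s / 2)
  + sqsum N f (z + ((s / 2)%:C)%C + 'I * ((s / 2)%:C)%C) (s / 2).
Proof.
rewrite /sqsum !segsumS.
have h2 : (s%:C)%C / 2 = ((s / 2)%:C)%C :> C.
  by rewrite rmorphM/= fmorphV rmorph_nat.
have hs : (s%:C)%C = ((s / 2)%:C)%C + ((s / 2)%:C)%C :> C.
  by rewrite -rmorphD/=; congr (_%:C)%C; field.
rewrite -!mulrA !h2 hs; set d := ((s / 2)%:C)%C.
rewrite !mulrDr !addrA.
have -> : z + 'I * d + d = z + d + 'I * d by ring.
have -> : z + 'I * d + 'I * d + d = z + d + 'I * d + 'I * d by ring.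
have -> : z + d + 'I * d + d = z + d + d + 'I * d by ring.
ring.
Qed.

Lemma sqsumD N f g z s :
  sqsum N (fun x => f x + g x) z s = sqsum N f z s + sqsum N g z s.
Proof. rewrite /sqsum !segsumD; ring. Qed.

Lemma sqsumM N k f z s : sqsum N (fun x => k * f x) z s = k * sqsum N f z s.
Proof. rewrite /sqsum !segsumM; ring. Qed.

Lemma sqsum_affine N (a b c z : C) s : sqsum N (fun x => a + b * (x - c)) z s = 0.
Proof. by rewrite /sqsum !segsum_affine; field. Qed.

Definition in_square z (s : R) (x : C) : Prop :=
  (0 <= complex.Re (x - z) <= s) && (0 <= complex.Im (x - z) <= s).

Definition on_boundary z (s : R) (x : C) : Prop :=
  in_square z s x /\
  [|| complex.Re (x - z) == 0, complex.Re (x - z) == s,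
      complex.Im (x - z) == 0 | complex.Im (x - z) == s].

Lemma sqsum_le N f z s (B : R) : 0 <= s ->
  (forall x, on_boundary z s x -> normc (f x) <= B) ->
  normc (sqsum N f z s) <= 4 * s * B.
Proof.
move=> s0 fB.
have key z' d : normc d = s ->
    (forall t : R, 0 <= t <= 1 -> on_boundary z s (z' + (t%:C)%C * d)) ->
    normc (segsum N f z' d) <= B * s.
  by move=> nd h; rewrite -[in leRHS]nd; apply: segsum_le => t t01; apply: fB; apply: h.
have ns : normc (s%:C)%C = s by rewrite normc_real ger0_norm.
have ni : normc ('I * (s%:C)%C) = s by rewrite normc_i ger0_norm.
have ts t : 0 <= t <= 1 -> 0 <= t * s <= s by move=> ?; apply/andP; split; nra.
have k1 : normc (segsum N f z (s%:C)%C) <= B * s.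
  apply: key => // t /ts ht; rewrite /on_boundary /in_square.
  have -> : z + (t%:C)%C * (s%:C)%C - z = (t * s +i* 0)%C.
    by rewrite addrAC subrr add0r -rmorphM.
  by rewrite /= ht lexx s0 eqxx /= !orbT.
have k2 : normc (segsum N f (z + (s%:C)%C) ('I * (s%:C)%C)) <= B * s.
  apply: key => // t /ts ht; rewrite /on_boundary /in_square.
  have -> : z + (s%:C)%C + (t%:C)%C * ('I * (s%:C)%C) - z = (s +i* (t * s))%C.
    by rewrite addrAC [z + _]addrC addrK; simpc.
  by rewrite /= ht lexx s0 eqxx /= !orbT.
have k3 : normc (segsum N f (z + 'I * (s%:C)%C) (s%:C)%C) <= B * s.
  apply: key => // t /ts ht; rewrite /on_boundary /in_square.
  have -> : z + 'I * (s%:C)%C + (t%:C)%C * (s%:C)%C - z = (t * s +i* s)%C.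
    by rewrite addrAC [z + _]addrC addrK; simpc.
  by rewrite /= ht lexx s0 eqxx /= !orbT.
have k4 : normc (segsum N f z ('I * (s%:C)%C)) <= B * s.
  apply: key => // t /ts ht; rewrite /on_boundary /in_square.
  have -> : z + (t%:C)%C * ('I * (s%:C)%C) - z = (0 +i* (t * s))%C.
    by rewrite addrAC subrr add0r; simpc.
  by rewrite /= ht lexx s0 eqxx /=.
rewrite /sqsum.
apply: le_trans (ler_normcD _ _) _; rewrite normc_opp.
have := ler_normcD (segsum N f z (s%:C)%C) (segsum N f (z + (s%:C)%C) ('I * (s%:C)%C)).
have := ler_normcD (segsum N f z (s%:C)%C + segsum N f (z + (s%:C)%C) ('I * (s%:C)%C))
   (- segsum N f (z + 'I * (s%:C)%C) (s%:C)%C).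
rewrite normc_opp; lra.
Qed.

(** All nodes are boundary points, so identities that break down at poles inside the square may
    still be summed. *)
Lemma sqsum_eq N f g z s : 0 <= s ->
  (forall x, on_boundary z s x -> f x = g x) -> sqsum N f z s = sqsum N g z s.
Proof.
move=> s0 fg; apply/eqP; rewrite -subr_eq0; apply/eqP.
have -> : sqsum N f z s - sqsum N g z s = sqsum N (fun x => f x + -1 * g x) z s.
  by rewrite sqsumD sqsumM mulN1r.
apply: eq0_normc; apply/eqP; rewrite eq_le normc_ge0 andbT.
rewrite -[leRHS](mulr0 (4 * s)); apply: sqsum_le => // x /fg ->.
by rewrite mulN1r subrr normc0.
Qed.

Lemma in_square_dist z s x y : in_square z s x -> in_square z s y ->
  normc (x - y) <= 2 * s.
Proof.
move=> /andP[h1 h2] /andP[h3 h4]; apply: le_trans (normc_ReIm _) _.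
have -> : x - y = (x - z) - (y - z) by ring.
move: h1 h2 h3 h4; case: (x - z) => a b; case: (y - z) => a' b' /= *.
have : `|a - a'| <= s by rewrite ler_norml; lra.
have : `|b - b'| <= s by rewrite ler_norml; lra.
lra.
Qed.

End MidpointSums.

(** * Goursat by bisection *)

Section Bisection.
Variable R : realType.
Local Notation C := R[i].
Local Notation "'I" := ('i%C : C).

Lemma exists_halving_lt (s e : R) : 0 < s -> 0 < e -> exists k, s / 2 ^+ k < e.
Proof.
move=> s0 e0; exists (Num.bound (s / e)).
rewrite ltr_pdivrMr ?exprn_gt0// mulrC -ltr_pdivrMr//.
have /archi_boundP h : 0 <= s / e by rewrite divr_ge0 ?ltW.
apply: lt_le_trans h _; rewrite -natrX ler_nat; exact/ltnW/ltn_expl.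
Qed.

Lemma nested_intervals (x s : nat -> R) : (forall k, 0 <= s k) ->
  (forall k, x k <= x k.+1) -> (forall k, x k.+1 + s k.+1 <= x k + s k) ->
  exists c, forall k, x k <= c <= x k + s k.
Proof.
move=> s0 xS xsS.
have xm i j : (i <= j)%N -> x i <= x j.
  move=> /subnK <-; elim: (j - i)%N => [//|k IH].
  by rewrite addSn; apply: le_trans IH (xS _).
have xsm i j : (i <= j)%N -> x j + s j <= x i + s i.
  move=> /subnK <-; elim: (j - i)%N => [//|k IH].
  by rewrite addSn; apply: le_trans (xsS _) IH.
have xub k : ubound (range x) (x k + s k).
  move=> _ [j _ <-]; have [jk|kj] := leqP j k.
    by apply: le_trans (xm _ _ jk) _; rewrite lerDl.
  by apply: le_trans (xsm _ _ (ltnW kj)); rewrite lerDl.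
exists (sup (range x)) => k; apply/andP; split.
  by apply: ub_le_sup; [exists (x 0%N + s 0%N); apply: xub|exists k].
by apply: ge_sup; [exists (x 0%N), 0%N|apply: xub].
Qed.

(** If [P] fails on a square, it fails on one of its quarters. Iterating gives nested squares
    shrinking to a common point, where the local hypothesis is contradicted. *)
Lemma square_bisection (P : C -> R -> Prop) z0 s0 : 0 < s0 ->
  (forall z s, 0 < s -> P z (s / 2) -> P (z + ((s / 2)%:C)%C) (s / 2) ->
     P (z + 'I * ((s / 2)%:C)%C) (s / 2) ->
     P (z + ((s / 2)%:C)%C + 'I * ((s / 2)%:C)%C) (s / 2) -> P z s) ->
  (forall c, in_square z0 s0 c -> exists2 d, 0 < d &
     forall z s, 0 < s < d -> in_square z s c -> P z s) ->
  P z0 s0.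
Proof.
move=> s00 Pher Ploc; apply: contrapT => nP.
(* The first quarter on which [P] fails; the last one is not tested, since it must fail when the
   other three succeed. *)
pose nxt (z : C) (s : R) : C := let h := ((s / 2)%:C)%C in
  if `[< ~ P z (s / 2) >] then z else
  if `[< ~ P (z + h) (s / 2) >] then z + h else
  if `[< ~ P (z + 'I * h) (s / 2) >] then z + 'I * h else z + h + 'I * h.
pose sk k : R := s0 / 2 ^+ k.
have sk0 k : 0 < sk k by rewrite divr_gt0 ?exprn_gt0.
have skS k : sk k / 2 = sk k.+1 by rewrite /sk exprSr invfM mulrA.
pose zk := fix F k := if k is k'.+1 then nxt (F k') (sk k') else z0.
have nxtP z s : 0 < s -> ~ P z s -> ~ P (nxt z s) (s / 2).
  move=> sp nPz; rewrite /nxt.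
  case: asboolP => // /contrapT h1; case: asboolP => // /contrapT h2.
  case: asboolP => // /contrapT h3 h4.
  exact: nPz (Pher _ _ sp h1 h2 h3 h4).
have nPk k : ~ P (zk k) (sk k).
  elim: k => [|k IH]; first by rewrite /sk expr0 divr1.
  by rewrite -skS; apply: nxtP.
have nxtRe z s : 0 < s -> (complex.Re z <= complex.Re (nxt z s) <= complex.Re z + s / 2).
  rewrite /nxt; case: z => a b sp; (do ?[case: ifP => _]); rewrite /=; lra.
have nxtIm z s : 0 < s -> (complex.Im z <= complex.Im (nxt z s) <= complex.Im z + s / 2).
  rewrite /nxt; case: z => a b sp; (do ?[case: ifP => _]); rewrite /=; lra.
have [|||x hx] := @nested_intervals (fun k => complex.Re (zk k)) sk.
- by move=> k; apply: ltW.
- by move=> k; case/andP: (nxtRe (zk k) _ (sk0 k)).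
- by move=> k; case/andP: (nxtRe (zk k) _ (sk0 k)) => _; rewrite /= -skS; lra.
have [|||y hy] := @nested_intervals (fun k => complex.Im (zk k)) sk.
- by move=> k; apply: ltW.
- by move=> k; case/andP: (nxtIm (zk k) _ (sk0 k)).
- by move=> k; case/andP: (nxtIm (zk k) _ (sk0 k)) => _; rewrite /= -skS; lra.
have inQ k : in_square (zk k) (sk k) (x +i* y)%C.
  move: (hx k) (hy k); rewrite /in_square; case: (zk k) => a b /= h1 h2.
  apply/andP; split; lra.
have [|d d0 hd] := Ploc (x +i* y)%C.
  by move: (inQ 0%N); rewrite /sk expr0 divr1.
have [k hk] := exists_halving_lt s00 d0.
by apply: (nPk k); apply: hd => //; rewrite sk0.
Qed.

(* Counts a point of a closed interval once, twice if it is interior, so that a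
   bisection at the point itself does not increase the total. *)
Definition interval_mult (x a s : R) : R :=
  (a <= x <= a + s)%R%:R + (a < x < a + s)%R%:R.

(** The critical case is [x] at the midpoint: it counts once in each half as an endpoint and twice
    in the whole as an interior point. *)
Lemma interval_mult_bisect x a s : 0 < s ->
  interval_mult x a (s / 2) + interval_mult x (a + s / 2) (s / 2)
    <= interval_mult x a s.
Proof.
move=> s0; rewrite /interval_mult.
have -> : a + s / 2 + s / 2 = a + s by field.
have [h1|h1|h1] := ltgtP a x; have [h2|h2|h2] := ltgtP x (a + s / 2);
 have [h3|h3|h3] := ltgtP x (a + s); rewrite /=; lra.
Qed.

Lemma interval_mult_ge0 x a s : 0 <= interval_mult x a s.
Proof. by rewrite addr_ge0. Qed.

Lemma interval_mult_le2 x a s : interval_mult x a s <= 2.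
Proof. by rewrite /interval_mult; do 2 case: (_ && _); rewrite /=; lra. Qed.

(** A point counts 4 times in the interior, twice on an open side and once at a corner, so quarters
    sharing the point together charge no more than the whole square. *)
Definition square_mult (p z : C) (s : R) : R :=
  interval_mult (complex.Re p) (complex.Re z) s
  * interval_mult (complex.Im p) (complex.Im z) s.

Lemma square_mult_bisect p z s : 0 < s -> let h := ((s / 2)%:C)%C in
  square_mult p z (s / 2) + square_mult p (z + h) (s / 2)
  + square_mult p (z + 'I * h) (s / 2) + square_mult p (z + h + 'I * h) (s / 2)
  <= square_mult p z s.
Proof.
move=> s0; case: z => a b; rewrite /square_mult /=.
rewrite !(mul0r, mulr0, mul1r, add0r, addr0, subr0).
have := interval_mult_bisect (complex.Re p) a s0.
have := interval_mult_bisect (complex.Im p) b s0.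
have := interval_mult_ge0 (complex.Re p) a (s / 2).
have := interval_mult_ge0 (complex.Re p) (a + s / 2) (s / 2).
have := interval_mult_ge0 (complex.Im p) b (s / 2).
have := interval_mult_ge0 (complex.Im p) (b + s / 2) (s / 2).
set u1 := interval_mult _ _ _; set u2 := interval_mult _ _ _.
set u3 := interval_mult _ _ _; set u4 := interval_mult _ _ _.
set u5 := interval_mult _ _ _; set u6 := interval_mult _ _ _ => *.
nra.
Qed.

Lemma square_mult_ge0 p z s : 0 <= square_mult p z s.
Proof. by rewrite mulr_ge0 ?interval_mult_ge0. Qed.

Lemma square_mult_ge1 p z s : in_square z s p -> 1 <= square_mult p z s.
Proof.
rewrite /in_square /square_mult /interval_mult; case: z => a b; case: p => x y /=.
move=> /andP[h1 h2].
have -> : a <= x <= a + s by lra.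
have -> : b <= y <= b + s by lra.
have k (b1 : bool) : 1 <= 1 + b1%:R :> R by case: b1 => /=; lra.
by have := k (a < x < a + s); have := k (b < y < b + s) => *; rewrite /=; nra.
Qed.

Lemma square_mult_le4 p z s : square_mult p z s <= 4.
Proof.
have := interval_mult_le2 (complex.Re p) (complex.Re z) s.
have := interval_mult_le2 (complex.Im p) (complex.Im z) s.
have := interval_mult_ge0 (complex.Re p) (complex.Re z) s.
have := interval_mult_ge0 (complex.Im p) (complex.Im z) s.
rewrite /square_mult => *; nra.
Qed.

End Bisection.

Section Goursat.
Variable R : realType.
Local Notation C := R[i].
Local Notation "'I" := ('i%C : C).

Definition cdiff (f : C -> C) (c : C) : Prop :=
  exists b : C, forall e : R, 0 < e -> exists2 d : R, 0 < d &
    forall x, normc (x - c) < d ->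
      normc (f x - f c - b * (x - c)) <= e * normc (x - c).

(** The estimate [e * (area + multiplicity of p)] is inherited from quarters by their union. Small
    squares away from [p] are paid for by the area, through the affine approximation of [f]; small
    squares containing [p] are paid for by the multiplicity, since [f] is bounded near [p] and the
    perimeter is small. *)
Lemma goursat (f : C -> C) (p z0 : C) (s0 : R) : 0 < s0 ->
  (forall c, in_square z0 s0 c -> c != p -> cdiff f c) ->
  (exists B d : R, 0 < d /\ forall x, normc (x - p) < d -> normc (f x) <= B) ->
  forall e : R, 0 < e -> exists N0, forall N, (N0 <= N)%N ->
    normc (sqsum N f z0 s0) <= e.
Proof.
move=> s00 fd [B [r [r0 fB]]] e0 e00.
(* The denominator is the area plus 4, the largest value of [square_mult]. *)
pose e := e0 / (s0 * s0 + 4).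
have den0 : 0 < s0 * s0 + 4 by nra.
have ep : 0 < e by rewrite divr_gt0.
suff [N0 hN] : exists N0, forall N, (N0 <= N)%N ->
    normc (sqsum N f z0 s0) <= e * (s0 * s0 + square_mult p z0 s0).
  exists N0 => N /hN h; apply: le_trans h _.
  have -> : e0 = e * (s0 * s0 + 4) by rewrite /e divfK ?gt_eqF.
  by rewrite ler_pM2l// lerD2l square_mult_le4.
apply: (@square_bisection _ (fun z s => exists N0, forall N, (N0 <= N)%N ->
    normc (sqsum N f z s) <= e * (s * s + square_mult p z s))) => //.
  move=> z s sp [n1 h1] [n2 h2] [n3 h3] [n4 h4].
  (* The successor pays for the refinement level consumed by the bisection. *)
  exists (n1 + n2 + n3 + n4).+1 => -[//|N] hN; rewrite ltnS in hN.
  rewrite sqsumS.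
  have /h1 k1 : (n1 <= N)%N by apply: leq_trans hN; rewrite -!addnA leq_addr.
  have /h2 k2 : (n2 <= N)%N by apply: leq_trans hN; rewrite -!addnA addnCA leq_addr.
  have /h3 k3 : (n3 <= N)%N by apply: leq_trans hN; rewrite addnAC leq_addl.
  have /h4 k4 : (n4 <= N)%N by apply: leq_trans hN; rewrite leq_addl.
  have q := square_mult_bisect p z sp; cbv zeta in q.
  set A1 := sqsum N f z _ in k1 *; set A2 := sqsum N f _ _ in k2 *.
  set A3 := sqsum N f _ _ in k3 *; set A4 := sqsum N f _ _ in k4 *.
  have j1 := ler_normcD (A1 + A2 + A3) A4.
  have j2 := ler_normcD (A1 + A2) A3.
  have j3 := ler_normcD A1 A2.
  move: q k1 k2 k3 k4; set w := square_mult p z s.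
  set w1 := square_mult _ _ _; set w2 := square_mult _ _ _.
  set w3 := square_mult _ _ _; set w4 := square_mult _ _ _ => q k1 k2 k3 k4.
  have : e * (w1 + w2 + w3 + w4) <= e * w by rewrite ler_pM2l.
  have : normc A1 + normc A2 + normc A3 + normc A4 <= e * (s * s) + e * (w1 + w2 + w3 + w4) by lra.
  lra.
move=> c cQ; have [cp|cp] := eqVneq c p.
  have B0 : 0 <= B.
    by apply: le_trans (fB p _); rewrite ?normc_ge0// subrr normc0.
  (* Two points of the square are at most [2 * s] apart, so [r / 2] keeps it where [f] is bounded by
     [B]; the second bound makes [4 * s * B] at most [e]. *)
  exists (Num.min (r / 2) (e / (4 * B + 1))).
    by rewrite lt_min !divr_gt0 //; lra.
  move=> z s; rewrite lt_min => /and3P[sp sr se] inQ; exists 0%N => N _.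
  have k : normc (sqsum N f z s) <= 4 * s * B.
    apply: sqsum_le; first exact: ltW.
    move=> x [xQ _]; apply: fB; rewrite -cp.
    apply: le_lt_trans (in_square_dist xQ inQ) _; lra.
  rewrite cp in inQ; have w1 := square_mult_ge1 inQ.
  have se' : s * (4 * B + 1) < e by rewrite -ltr_pdivlMr//; lra.
  have : e * 1 <= e * (s * s + square_mult p z s) by rewrite ler_pM2l//; nra.
  lra.
(* With perimeter [4 * s] and distances at most [2 * s], the factor [e / 8] yields exactly
   [e * (s * s)]. *)
have [b hb] := fd c cQ cp; have [|d d0 hd] := hb (e / 8); first by lra.
exists (d / 2); first by lra.
move=> z s /andP[sp sd] inQ; exists 0%N => N _.
(* The affine part has boundary sum 0 and can be subtracted. *)
have -> : sqsum N f z s = sqsum N (fun x => f x + -1 * (f c + b * (x - c))) z s.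
  by rewrite sqsumD sqsumM sqsum_affine mulr0 addr0.
have k : normc (sqsum N (fun x => f x + -1 * (f c + b * (x - c))) z s) <= 4 * s * (e / 8 * (2 * s)).
  apply: sqsum_le; first exact: ltW.
  move=> x [xQ _]; have dx := in_square_dist xQ inQ.
  have -> : f x + -1 * (f c + b * (x - c)) = f x - f c - b * (x - c) by ring.
  apply: le_trans (hd _ _) _; first by apply: le_lt_trans dx _; lra.
  by rewrite ler_pM2l//; lra.
have w0 := square_mult_ge0 p z s.
have : e * (s * s) <= e * (s * s + square_mult p z s) by rewrite ler_pM2l//; lra.
lra.
Qed.

End Goursat.

(** * A Schwarz-type estimate *)

Section DifferentiableEps.
Variables (K : numFieldType) (V W : normedModType K).
Implicit Types f : V -> W.

Lemma differentiable_eps f x : differentiable f x -> forall e, 0 < e ->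
  exists2 d, 0 < d & forall h, `|h| < d ->
    `|f (x + h) - f x - 'd f x h| <= e * `|h|.
Proof.
move=> /diff_locally /eqaddoP fx e /fx /nbhs_ballP[d /= d0 hd].
exists d => // h hlt; have := hd h; rewrite -ball_normE /= sub0r normrN => /(_ hlt).
rewrite -[(_ - _) h]/(f (h + x) - (f x + 'd f x h)).
by rewrite opprD addrA [h + x]addrC.
Qed.

(** A continuous linear map with an o(h) remainder is the differential, by uniqueness; this is how a
    limit of differentials is recognised as a differential. *)
Lemma differentiable_approx f (df : {linear V -> W}) x : continuous df ->
  (forall e, 0 < e -> exists2 d, 0 < d & forall h, `|h| < d ->
    `|f (x + h) - f x - df h| <= e * `|h|) ->
  differentiable f x.
Proof.
move=> dfc fx.
have fo : f \o shift x = cst (f x) + df +o_ 0 id.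
  apply/eqaddoP => e /fx[d d0 hd]; apply/nbhs_ballP; exists d => // h.
  rewrite -ball_normE /= sub0r normrN => /hd.
  rewrite -[(_ - _) h]/(f (h + x) - (f x + df h)).
  by rewrite opprD addrA [h + x]addrC.
by apply/diff_locallyP; rewrite (diff_unique dfc fo).
Qed.

End DifferentiableEps.

Section Schwarz.
Variable R : realType.
Local Notation C := R[i].
Local Notation "'I" := ('i%C : C).

(** A complex-linear map on the complex line is multiplication by its value at 1. *)
Lemma differentiable_cdiff (f : CC R -> CC R) (c : CC R) :
  differentiable f c -> cdiff f c.
Proof.
move=> fc; exists ('d f c (1 : C)) => e e0.
have [|d d0 hd] := differentiable_eps fc (e := (e%:C)%C); first by rewrite ltcR.
have [dE d0'] := posC d0; exists (complex.Re d) => // x xc.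
have := hd (x - c).
rewrite [c + _]addrC subrK.
have -> : 'd f c (x - c : C) = 'd f c (1 : C) * (x - c).
  rewrite -[X in 'd f c X](mulr1 (x - c : C)).
  have -> : (x - c) * 1 = (x - c) *: (1 : CC R) by [].
  by rewrite linearZ /= [LHS]mulrC.
move=> h; rewrite -lecR rmorphM; apply: h.
by rewrite dE; rewrite normc_norm ltcR.
Qed.

(** The sum is an average of the values of [f * d] at the nodes, so a pointwise lower bound
    survives. *)
Lemma segsum_Im_ge N (f : C -> C) z d (B : R) :
  (forall t : R, 0 <= t <= 1 -> B <= complex.Im (f (z + (t%:C)%C * d) * d)) ->
  B <= complex.Im (segsum N f z d).
Proof.
have h2 : ((2^-1)%:C)%C = 2^-1 :> C by rewrite fmorphV rmorph_nat.
have Im2 (w : C) : complex.Im (w / 2) = complex.Im w / 2.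
  by rewrite -h2; case: w => a b /=; rewrite mulr0 add0r.
elim: N z d B => [|N IH] z d B fB.
  have /fB : 0 <= (2^-1 : R) <= 1 by lra.
  by rewrite h2 mulrC [2^-1 * d]mulrC mulrC.
rewrite segsumS raddfD /= -[B](@divfK _ 2)// mulrDr mulr1; apply: lerD; apply: IH => t t01.
  have -> : (t%:C)%C * (d / 2) = ((t / 2)%:C)%C * d.
    by rewrite rmorphM/= h2 mulrAC mulrA.
  rewrite mulrA Im2 ler_pM2r ?invr_gt0//; apply: fB; lra.
have -> : z + d / 2 + (t%:C)%C * (d / 2) = z + ((2^-1 + t / 2)%:C)%C * d.
  by rewrite rmorphD rmorphM/= h2; field.
rewrite mulrA Im2 ler_pM2r ?invr_gt0//; apply: fB; lra.
Qed.

Local Notation z0 := (- (1 +i* 1))%C.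

Lemma Im_invM (x y u v : R) :
  complex.Im ((x +i* y)^-1 * (u +i* v))%C = (x * v - y * u) / (x ^+ 2 + y ^+ 2).
Proof. by rewrite /=; ring. Qed.

(** A lower bound for the winding number integral, whose value is 2 pi i. The square is centred at 0
    with half side 1; on each side the imaginary part of the integrand times the oriented side is 2
    / (x^2 + 1) with |x| at most 1, so each side contributes at least 1. *)
Lemma winding_ge N : 4 <= normc (sqsum N (fun x => x^-1) z0 2 : C).
Proof.
apply: le_trans (normc_Im _); apply: le_trans (ler_norm _).
have aux (x u v : R) : -1 <= x <= 1 -> u = 2 -> v = x ^+ 2 + 1 -> 1 <= u / v.
  move=> hx -> ->; rewrite ler_pdivlMr; first by rewrite expr2; nra.
  by rewrite expr2; nra.
have b1 : 1 <= complex.Im (segsum N (fun x => x^-1) z0 (2%:C)%C : C).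
  apply: segsum_Im_ge => t t01.
  have -> : z0 + (t%:C)%C * (2%:C)%C = ((-1 + t * 2) +i* -1)%C :> C.
    by rewrite -rmorphM; simpc.
  rewrite Im_invM; apply: (aux (-1 + t * 2)); [lra|ring|ring].
have b2 : 1 <= complex.Im (segsum N (fun x => x^-1) (z0 + (2%:C)%C) ('I * (2%:C)%C) : C).
  apply: segsum_Im_ge => t t01.
  have -> : z0 + (2%:C)%C + (t%:C)%C * ('I * (2%:C)%C) = (1 +i* (-1 + t * 2))%C :> C.
    by simpc; congr (_ +i* _)%C; ring.
  have -> : 'I * (2%:C)%C = (0 +i* 2)%C :> C by simpc.
  rewrite Im_invM; apply: (aux (-1 + t * 2)); [lra|ring|ring].
have b3 : 1 <= complex.Im (segsum N (fun x => -1 * x^-1) (z0 + 'I * (2%:C)%C) (2%:C)%C : C).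
  apply: segsum_Im_ge => t t01.
  have -> : z0 + 'I * (2%:C)%C + (t%:C)%C * (2%:C)%C = ((-1 + t * 2) +i* 1)%C :> C.
    by simpc; congr (_ +i* _)%C; ring.
  rewrite -mulrA mulrCA.
  have -> : -1 * (2%:C)%C = (-2 +i* 0)%C :> C by rewrite mulN1r; simpc.
  rewrite Im_invM; apply: (aux (-1 + t * 2)); [lra|ring|ring].
have b4 : 1 <= complex.Im (segsum N (fun x => -1 * x^-1) z0 ('I * (2%:C)%C) : C).
  apply: segsum_Im_ge => t t01.
  have -> : z0 + (t%:C)%C * ('I * (2%:C)%C) = (-1 +i* (-1 + t * 2))%C :> C.
    by simpc; congr (_ +i* _)%C; ring.
  rewrite -mulrA mulrCA.
  have -> : -1 * ('I * (2%:C)%C) = (0 +i* -2)%C :> C by rewrite mulN1r; simpc.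
  rewrite Im_invM; apply: (aux (-1 + t * 2)); [lra|ring|ring].
move: b1 b2 b3 b4; rewrite /sqsum; move: (2%:C)%C => d b1 b2 b3 b4.
rewrite -[- segsum _ _ (_ + _) d]mulN1r -[- segsum _ _ _ ('I * d)]mulN1r.
rewrite -!segsumM !raddfD /=; lra.
Qed.

Lemma differentiable_difference_quotient (f : CC R -> CC R) (p c : CC R) :
  c != p -> differentiable f c ->
  differentiable ((fun x => (f x - f p) / (x - p) : C) : CC R -> CC R) c.
Proof.
move=> cp fc.
have h1 : differentiable ((fun x => f x - f p) : CC R -> CC R) c.
  exact: (differentiableB fc (differentiable_cst (f p) c)).
have h2 : differentiable ((fun x => x - p) : CC R -> CC R) c.
  exact: (differentiableB (f := id) (ex_diff) (differentiable_cst p c)).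
have h3 : differentiable ((fun x => (x - p : C)^-1) : CC R -> CC R) c.
  by apply: (@differentiableV C _ _ c h2); rewrite subr_eq0.
exact: (@differentiableM C _ _ _ c h1 h3).
Qed.

Lemma boundary_normc_ge1 (x : C) : on_boundary z0 2 x -> 1 <= normc x.
Proof.
move=> [_]; rewrite opprK; case: x => a b /= h.
have : 1 <= `|a| \/ 1 <= `|b|.
  case/or4P: h => /eqP h; [left|left|right|right].
  - have -> : a = -1 by lra.
    by rewrite normrN1.
  - have -> : a = 1 by lra.
    by rewrite normr1.
  - have -> : b = -1 by lra.
    by rewrite normrN1.
  - have -> : b = 1 by lra.
    by rewrite normr1.
by case=> /le_trans; apply; [exact: (normc_Re (a +i* b)%C)|exact: (normc_Im (a +i* b)%C)].
Qed.

(** Let q_p(x) = (f x - f p) / (x - p). On the boundary q_a = q_0 + k - (f a - f 0) / x, where k is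
    of order |a|. The sums of q_a and q_0 tend to 0 by [goursat], and that of 1 / x has modulus at
    least 4, which bounds f a - f 0. *)
Lemma schwarz_square (f : CC R -> CC R) (M : R) (a : C) :
  (forall x : CC R, in_square z0 2 x -> differentiable f x /\ normc (f x) <= M) ->
  normc a <= 1 / 2 -> normc (f a - f 0) <= 8 * M * normc a.
Proof.
move=> hf a2.
have aQ : in_square z0 2 a.
  have := normc_Re a; have := normc_Im a; move: a2; rewrite /in_square opprK.
  set A := normc a => h1; case: {hf} a A h1 => x y A h1 /=.
  rewrite !ler_norml => h2 h3; apply/andP; split; lra.
have oQ : in_square z0 2 (0 : C).
  by rewrite /in_square opprK add0r /=; apply/andP; split; lra.
pose q (p x : C) : C := (f x - f p) / (x - p).
have T0 p : in_square z0 2 p -> forall e : R, 0 < e -> exists N0, forall N, (N0 <= N)%N ->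
    normc (sqsum N (q p) z0 2 : C) <= e.
  move=> pQ; apply: (@goursat _ _ p) => //.
    move=> c cQ cp; apply: differentiable_cdiff.
    by apply: differentiable_difference_quotient => //; case: (hf c cQ).
  have [b hb] := differentiable_cdiff (hf p pQ).1.
  have [d d0 hd] := hb 1 ltr01.
  (* Near [p] the quotient is within 1 of the derivative [b]; at [p] itself division by zero gives
     the value 0. *)
  exists (normc b + 1), d; split => // x xp; rewrite /q.
  have [->|xnp] := eqVneq x p; first by rewrite subrr mul0r normc0 addr_ge0 ?normc_ge0.
  have xp0 : 0 < normc (x - p) by rewrite normc_gt0 subr_eq0.
  rewrite normcM normcV ler_pdivrMr// mulrDl -normcM.
  have := ler_normcD (f x - f p - b * (x - p)) (b * (x - p)).
  rewrite subrK; have := hd x xp; lra.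
have M0 : 0 <= M by apply: le_trans (hf 0 oQ).2; rewrite normc_ge0.
apply/ler_addgt0Pl => e e0.
have [N1 h1] := T0 a aQ e e0; have [N2 h2] := T0 0 oQ e e0.
pose N := (N1 + N2)%N.
have {}h1 := h1 N (leq_addr _ _); have {}h2 := h2 N (leq_addl _ _).
(* This is (f x - f a) * (1 / (x - a) - 1 / x) on a common denominator. *)
pose k (x : C) : C := (f x - f a) * a / (x * (x - a)).
(* The perimeter is [4 * 2]; the numerator of [k] is at most [2 * M * normc a] and its denominator
   at least 1 / 2. *)
have bnd : normc (sqsum N k z0 2 : C) <= 4 * 2 * (4 * M * normc a).
  apply: sqsum_le => // x xb.
  have x1 := boundary_normc_ge1 xb.
  have x2 : 1 / 2 <= normc (x - a).
    by have := ler_normcD (x - a) a; rewrite subrK; lra.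
  have fx := (hf x xb.1).2; have fa := (hf a aQ).2.
  have fxa : normc (f x - f a) <= 2 * M.
    by have := ler_normcD (f x) (- f a); rewrite normc_opp; lra.
  rewrite /k !normcM normcV normcM ler_pdivrMr; last by nra.
  have xx : 1 / 2 <= normc x * normc (x - a) by nra.
  have a0 := normc_ge0 a.
  apply: (@le_trans _ _ (2 * M * normc a)); first by rewrite ler_wpM2r.
  have Ma : 0 <= M * normc a by rewrite mulr_ge0.
  nra.
have E : sqsum N (q a) z0 2 =
   sqsum N (q 0) z0 2 + (sqsum N k z0 2 + - (f a - f 0) * sqsum N (fun x => x^-1) z0 2).
  rewrite -sqsumM -!sqsumD.
  apply: sqsum_eq => // x xb; rewrite /q /k.
  have x0 : x != 0 by rewrite -normc_gt0; apply: lt_le_trans (boundary_normc_ge1 xb).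
  have xa : x - a != 0.
    rewrite -normc_gt0; have := ler_normcD (x - a) a; rewrite subrK.
    have := boundary_normc_ge1 xb; lra.
  by field; rewrite ?x0 ?xa.
have W := winding_ge N.
set w := sqsum N (fun x => x^-1) z0 2 in E W.
have E2 : (f a - f 0) * w = sqsum N (q 0) z0 2 + sqsum N k z0 2 - sqsum N (q a) z0 2.
  by rewrite E; ring.
have : normc ((f a - f 0) * w) <= e + 4 * 2 * (4 * M * normc a) + e.
  rewrite E2; apply: le_trans (ler_normcD _ _) _; rewrite normc_opp; apply: lerD => //.
  by apply: le_trans (ler_normcD _ _) _; apply: lerD.
rewrite normcM; have := normc_ge0 (f a - f 0); set F := normc _ => F0 h.
have : F * 4 <= F * normc w by rewrite ler_wpM2l.
lra.
Qed.

End Schwarz.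

(** * Weierstrass's theorem *)

Section CauchySequences.
Variable R : realType.

Lemma natSinv_small (e : R) : 0 < e ->
  exists N, forall k, (N <= k)%N -> k.+1%:R^-1 <= e.
Proof.
move=> e0; have [N _ h] := near_infty_natSinv_lt (PosNum e0).
by exists N => k /h /ltW.
Qed.

Lemma real_cauchy_limit (u : nat -> R) :
  (forall e : R, 0 < e -> exists N, forall p q, (N <= p)%N -> (N <= q)%N ->
     `|u p - u q| <= e) ->
  exists l, forall e : R, 0 < e -> exists N, forall p, (N <= p)%N -> `|u p - l| <= e.
Proof.
move=> uC.
have : cvg (u @ \oo).
  apply: R_complete; apply: cauchy_exP => e e0.
  have [|N hN] := uC (e / 2); first by lra.
  exists (u N); exists N => // k /= Nk; rewrite -ball_normE /=.
  by apply: le_lt_trans (hN _ _ (leqnn N) Nk) _; lra.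
move=> /cvgrPdist_le h; exists (lim (u @ \oo)) => e /h[N _ hN].
by exists N => p /hN; rewrite distrC.
Qed.

Lemma complex_cauchy_limit (u : nat -> R[i]) :
  (forall e : R, 0 < e -> exists N, forall p q, (N <= p)%N -> (N <= q)%N ->
     normc (u p - u q) <= e) ->
  exists l, forall e : R, 0 < e -> exists N, forall p, (N <= p)%N -> normc (u p - l) <= e.
Proof.
move=> uC.
have [a ha] : exists l, forall e : R, 0 < e -> exists N, forall p, (N <= p)%N ->
    `|complex.Re (u p) - l| <= e.
  apply: real_cauchy_limit => e /uC[N hN]; exists N => p q /hN/[apply] h.
  by apply: le_trans h; rewrite -raddfB; exact: normc_Re.
have [b hb] : exists l, forall e : R, 0 < e -> exists N, forall p, (N <= p)%N ->
    `|complex.Im (u p) - l| <= e.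
  apply: real_cauchy_limit => e /uC[N hN]; exists N => p q /hN/[apply] h.
  by apply: le_trans h; rewrite -raddfB; exact: normc_Im.
exists (a +i* b)%C => e e0.
have [|N1 h1] := ha (e / 2); first by lra.
have [|N2 h2] := hb (e / 2); first by lra.
exists (N1 + N2)%N => p hp.
have := h1 p (leq_trans (leq_addr _ _) hp); have := h2 p (leq_trans (leq_addl _ _) hp).
have := normc_ReIm (u p - (a +i* b)%C); rewrite !raddfB /=; lra.
Qed.

End CauchySequences.

Section Weierstrass.
Variable R : realType.
Local Notation C := R[i].
Variable V : normedModType C.
Implicit Types (g h : V -> CC R) (x y w : V).

(** The norm of [V] takes values in [R[i]]; this is the same number as an element of [R]. *)
Definition rnorm w : R := complex.Re `|w|.

Lemma rnormE w : `|w| = ((rnorm w)%:C)%C.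
Proof.
rewrite /rnorm; have : 0 <= `|w| by [].
by case: `|w| => a b; rewrite lecE /= => /andP[/eqP ->].
Qed.

Lemma rnorm_ge0 w : 0 <= rnorm w.
Proof. by rewrite -lecR -rnormE; exact: normr_ge0. Qed.

Lemma rnormZ (a : C) w : rnorm (a *: w) = normc a * rnorm w.
Proof. by apply: complexI; rewrite rmorphM/= -!rnormE normrZ. Qed.

Lemma rnorm_eq0 w : rnorm w = 0 -> w = 0.
Proof. by move=> w0; apply/normr0_eq0; rewrite rnormE w0. Qed.

(** Apply [schwarz_square] to [g] along the complex line through [x] in the direction [w]. *)
Lemma schwarz_ball g x (r M : R) w : 0 < r ->
  (forall y, rnorm (y - x) < r -> differentiable g y /\ normc (g y) <= M) ->
  rnorm w <= r / 8 -> normc (g (x + w) - g x) <= 32 * M / r * rnorm w.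
Proof.
move=> r0 hg wr.
have [w0|wn0] := eqVneq (rnorm w) 0.
  by rewrite w0 mulr0 (rnorm_eq0 w0) addr0 subrr normc0.
have w0 : 0 < rnorm w by rewrite lt_def wn0 rnorm_ge0.
(* The direction [u] has norm [r / 4], so parameters of modulus at most 2 stay inside the ball; [w]
   has parameter [c^-1], which is at most 1 / 2. *)
pose c : R := r / 4 / rnorm w.
have c0 : 0 < c by rewrite !divr_gt0.
pose u : V := (c%:C)%C *: w.
have nu : rnorm u = r / 4.
  by rewrite rnormZ normc_real gtr0_norm// /c divfK.
pose f : CC R -> CC R := fun t => g (x + t *: u).
have cu : (c^-1%:C)%C *: u = w.
  by rewrite scalerA -rmorphM mulVf ?gt_eqF// scale1r.
have := @schwarz_square _ f M (c^-1%:C)%C.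
have -> : f (c^-1%:C)%C = g (x + w) by rewrite /f cu.
have -> : f 0 = g x by rewrite /f scale0r addr0.
have ci : 0 <= c^-1 by rewrite invr_ge0 ltW.
have cE : c^-1 = 4 * rnorm w / r by rewrite /c; field; rewrite (gt_eqF r0) wn0.
rewrite normc_real ger0_norm//.
have -> : 8 * M * c^-1 = 32 * M / r * rnorm w by rewrite cE; ring.
apply; last by rewrite cE ler_pdivrMr//; lra.
move=> t tQ.
have tr : rnorm (x + t *: u - x) < r.
  rewrite [x + _]addrC addrK rnormZ nu.
  have : normc (t : C) <= 2.
    apply: le_trans (normc_ReIm _) _.
    move: tQ; rewrite /in_square opprK; case: t => a b /= /andP[h1 h2].
    have : `|a| <= 1 by rewrite ler_norml; lra.
    have : `|b| <= 1 by rewrite ler_norml; lra.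
    lra.
  move=> t2; have : normc (t : C) * (r / 4) <= 2 * (r / 4) by rewrite ler_pM2r//; lra.
  lra.
have [gd gM] := hg _ tr; split => //.
apply: (@differentiable_comp C _ _ _ (fun s : CC R => x + s *: u) g) => //.
Qed.

(** Divide the bound of [schwarz_ball] for [t *: w] by a small [t]; the error of the linear
    approximation costs at most [e]. *)
Lemma schwarz_diff g x (r M : R) w : 0 < r ->
  (forall y, rnorm (y - x) < r -> differentiable g y /\ normc (g y) <= M) ->
  normc ('d g x w) <= 32 * M / r * rnorm w.
Proof.
move=> r0 hg.
have gx : differentiable g x.
  by apply: (hg x _).1; rewrite subrr /rnorm normr0.
apply/ler_addgt0Pl => e e0.
have e1 : 0 < e / (rnorm w + 1) by rewrite divr_gt0// ltr_wpDl// rnorm_ge0.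
have [|d d0 hd] := differentiable_eps gx (e := ((e / (rnorm w + 1))%:C)%C).
  by rewrite ltcR.
have [dE d0'] := posC d0; set d' := complex.Re d in dE d0'.
(* Keeps [t * rnorm w] within the range of the linear approximation and of [schwarz_ball]; adding 1
   avoids a zero denominator. *)
pose t : R := Num.min (d' / 2) (r / 8) / (rnorm w + 1).
have m0 : 0 < Num.min (d' / 2) (r / 8) by rewrite lt_min !divr_gt0.
have w1 : 0 < rnorm w + 1 by rewrite ltr_wpDl// rnorm_ge0.
have w0 := rnorm_ge0 w.
have t0 : 0 < t by rewrite divr_gt0.
have tw : rnorm ((t%:C)%C *: w) = t * rnorm w by rewrite rnormZ normc_real gtr0_norm.
have twm : t * rnorm w <= Num.min (d' / 2) (r / 8).
  by rewrite /t mulrAC ler_pdivrMr// ler_pM2l//; lra.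
move: twm; rewrite le_min => /andP[twd twr]; clearbody t.
have h1 : normc (g (x + (t%:C)%C *: w) - g x) <= 32 * M / r * (t * rnorm w).
  by rewrite -tw; apply: schwarz_ball => //; rewrite tw.
have h2 : normc (g (x + (t%:C)%C *: w) - g x - (t%:C)%C * 'd g x w)
    <= e / (rnorm w + 1) * (t * rnorm w).
  rewrite -tw -lecR rmorphM/= -rnormE.
  have -> : (t%:C)%C * 'd g x w = 'd g x ((t%:C)%C *: w) by rewrite linearZ.
  by apply: hd; rewrite rnormE dE ltcR tw; lra.
have h3 : normc ((t%:C)%C * 'd g x w) <= 32 * M / r * (t * rnorm w) + e / (rnorm w + 1) * (t * rnorm w).
  set A := g _ - g x in h1 h2; set B := (t%:C)%C * _ in h2 *.
  have := ler_normcD A (- (A - B)); rewrite normc_opp opprB addrC subrK; lra.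
rewrite normcM normc_real gtr0_norm// in h3.
have h4 : normc ('d g x w) <= 32 * M / r * rnorm w + e / (rnorm w + 1) * rnorm w.
  rewrite -(ler_pM2l t0); lra.
have : e / (rnorm w + 1) * rnorm w <= e.
  by rewrite mulrAC ler_pdivrMr// ler_pM2l//; lra.
lra.
Qed.

(** The Schwarz bounds applied to differences of approximants show that their differentials at [x]
    converge to some [L], and that the increments of [h - g k] are small relative to [rnorm w].
    Comparing [h] with one good [g N] then makes [L] the differential of [h]. *)
Lemma differentiable_uniform_limit h x (r : R) : 0 < r ->
  (forall e : R, 0 < e -> exists g, forall y, rnorm (y - x) < r ->
     differentiable g y /\ normc (h y - g y) <= e) ->
  differentiable h x.
Proof.
move=> r0 happ.
pose e (k : nat) : R := k.+1%:R^-1.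
have e0 k : 0 < e k by rewrite invr_gt0.
have /choice[g hg] : forall k, exists g, forall y, rnorm (y - x) < r ->
    differentiable g y /\ normc (h y - g y) <= e k by move=> k; exact: happ.
have xx : rnorm (x - x) < r by rewrite subrr /rnorm normr0.
have gx k := (hg k x xx).1.
have gB k l y : rnorm (y - x) < r ->
    differentiable (g k - g l) y /\ normc ((g k - g l) y) <= e k + e l.
  move=> yr; have [d1 h1] := hg k y yr; have [d2 h2] := hg l y yr.
  split; first exact: differentiableB.
  have -> : (g k - g l) y = - (h y - g k y) + (h y - g l y) :> C.
    by rewrite -[LHS]/(g k y - g l y); ring.
  by apply: le_trans (ler_normcD _ _) _; rewrite normc_opp; apply: lerD.
have em k l : (k <= l)%N -> e l <= e k by move=> kl; rewrite lef_pV2 ?posrE// ler_nat.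
(* From here on only these four properties of the differentials matter: linearity, boundedness of
   the first, approximation of [g k], and the Cauchy estimate. *)
have [D [Dlin [q0 Dq] Deps K1]] : exists D : nat -> V -> C,
  [/\ forall k a u v, D k (a *: u + v) = a * D k u + D k v,
      exists q : R, forall w, normc (D 0%N w) <= q * rnorm w,
      forall k (d : R), 0 < d -> exists2 t : R, 0 < t & forall w, rnorm w < t ->
        normc (g k (x + w) - g k x - D k w) <= d * rnorm w
    & forall k l w, normc (D k w - D l w) <= 32 * (e k + e l) / r * rnorm w].
  exists (fun k w => 'd (g k) x w); split.
  - by move=> k a u v; rewrite linearD linearZ.
  - have [q q0 hq] := linear_lipschitz (diff_continuous (gx 0%N)).
    have [qE _] := posC q0; exists (complex.Re q) => w.
    by rewrite -lecR rmorphM/= -rnormE -qE; exact: hq.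
  - move=> k d d0; have [|q q0 hq] := differentiable_eps (gx k) (e := (d%:C)%C).
      by rewrite ltcR.
    have [qE q0'] := posC q0; exists (complex.Re q) => // w wq.
    by rewrite -lecR rmorphM/= -rnormE; apply: hq; rewrite rnormE qE ltcR.
  - move=> k l w.
    have E : 'd (g k - g l) x w = 'd (g k) x w - 'd (g l) x w :=
      congr1 (fun F : V -> CC R => F w) (diffB (gx k) (gx l)).
    have h1 := @schwarz_diff (g k - g l) x r (e k + e l) w r0 (gB k l).
    exact: (eq_rect _ (fun z : CC R => is_true (normc z <= _)) h1 _ E).
(* The factor 64 bounds [32 * (e k + e l)] once [l] is at least [k]. *)
have small (w : R) : 0 <= w -> forall d : R, 0 < d -> exists N, forall k, (N <= k)%N ->
    64 * e k / r * w <= d.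
  move=> w0 d d0; have [|N hN] := @natSinv_small R (d * r / (64 * w + 1)).
    by rewrite divr_gt0 ?mulr_gt0//; lra.
  exists N => k /hN; rewrite -/(e k) ler_pdivlMr; last by lra.
  move=> h1; rewrite mulrAC ler_pdivrMr//; have := e0 k; lra.
have /choice[L hL] : forall w, exists l, forall d : R, 0 < d -> exists N, forall k, (N <= k)%N ->
    normc (D k w - l) <= d.
  move=> w; apply: complex_cauchy_limit => d d0.
  have [N hN] := small _ (rnorm_ge0 w) d d0; exists N => p q Np Nq.
  apply: le_trans (K1 p q w) _.
  have -> : 32 * (e p + e q) / r * rnorm w
      = (64 * e p / r * rnorm w + 64 * e q / r * rnorm w) / 2 by field; rewrite gt_eqF.
  have := hN p Np; have := hN q Nq.
  by move: (64 * e p / r * rnorm w) (64 * e q / r * rnorm w) => *; lra.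
have K2 k w : normc (D k w - L w) <= 64 * e k / r * rnorm w.
  apply/ler_addgt0Pl => d d0; have [N hN] := hL w d d0.
  have := hN (N + k)%N (leq_addr _ _).
  have := K1 k (N + k)%N w; have /em := leq_addl N k.
  set l := (N + k)%N => el h1 h2.
  have : 32 * (e k + e l) / r * rnorm w <= 64 * e k / r * rnorm w.
    by rewrite ler_wpM2r ?rnorm_ge0// ler_pM2r ?invr_gt0//; lra.
  have := ler_normcD (D k w - D l w) (D l w - L w).
  rewrite addrA subrK; lra.
(* Apply [schwarz_ball] to [g l - g k] and let [l] grow. Uniform closeness alone would not give a
   bound proportional to [rnorm w]. *)
have K3 k w : rnorm w <= r / 8 ->
    normc (h (x + w) - g k (x + w) - (h x - g k x)) <= 64 * e k / r * rnorm w.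
  move=> wr; have xwr : rnorm (x + w - x) < r by rewrite [x + w]addrC addrK; lra.
  apply/ler_addgt0Pl => d d0.
  have [|N hN] := @natSinv_small R (d / 2); first by lra.
  pose l := (N + k)%N; have el : e l <= d / 2 := hN l (leq_addr _ _).
  have /em elk : (k <= l)%N := leq_addl N k.
  have h1 : normc (g l (x + w) - g k (x + w) - (g l x - g k x))
      <= 32 * (e l + e k) / r * rnorm w.
    exact: (@schwarz_ball (g l - g k) x r (e l + e k) w r0 (gB l k) wr).
  have h2 : 32 * (e l + e k) / r * rnorm w <= 64 * e k / r * rnorm w.
    by rewrite ler_wpM2r ?rnorm_ge0// ler_pM2r ?invr_gt0//; lra.
  have a1 := (hg l _ xwr).2; have a2 := (hg l _ xx).2.
  move: h1 h2 a1 a2.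
  move: (g l (x + w) : C) (g k (x + w) : C) (g l x : C) (g k x : C) (h (x + w) : C) (h x : C).
  move=> glw gkw gl gk hw hx h1 h2 a1 a2.
  have -> : hw - gkw - (hx - gk) = (glw - gkw - (gl - gk)) + (hw - glw) - (hx - gl) by ring.
  apply: le_trans (ler_normcD _ _) _; rewrite normc_opp.
  have := ler_normcD (glw - gkw - (gl - gk)) (hw - glw).
  lra.
have Llin : linear (L : V -> CC R).
  move=> a u v; apply/eqP; rewrite -subr_eq0; apply/eqP/eq0_normc/eqP.
  rewrite eq_le normc_ge0 andbT; apply/ler_addgt0Pl => d d0; rewrite addr0.
  have a1 : 0 < normc a + 1 by rewrite ltr_wpDl ?normc_ge0.
  have [|N1 h1] := hL (a *: u + v) (d / 3); first by lra.
  have [|N2 h2] := hL u (d / 3 / (normc a + 1)); first by rewrite divr_gt0//; lra.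
  have [|N3 h3] := hL v (d / 3); first by lra.
  pose k := (N1 + N2 + N3)%N.
  have /h1 {}h1 : (N1 <= k)%N by rewrite /k -addnA leq_addr.
  have /h2 {}h2 : (N2 <= k)%N by rewrite /k addnAC leq_addl.
  have /h3 {}h3 : (N3 <= k)%N by rewrite leq_addl.
  have {}h2 : normc (a * (D k u - L u)) <= d / 3.
    rewrite normcM; move: h2; rewrite ler_pdivlMr// => h2.
    apply: le_trans h2; rewrite mulrC ler_wpM2l ?normc_ge0//; lra.
  have -> : L (a *: u + v) - (a *: L u + L v) = - (D k (a *: u + v) - L (a *: u + v))
      + a * (D k u - L u) + (D k v - L v) :> C.
    rewrite Dlin.
    have -> : a *: L u = a * L u by [].
    ring.
  apply: le_trans (ler_normcD _ _) _.
  have := ler_normcD (- (D k (a *: u + v) - L (a *: u + v))) (a * (D k u - L u)).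
  rewrite normc_opp; lra.
pose Lm := GRing.isLinear.Build _ _ _ _ _ Llin.
pose Lf : {linear V -> CC R} := HB.pack L Lm.
apply: (@differentiable_approx _ _ _ _ Lf).
  (* [L] is bounded because [D 0] is and [L - D 0] is controlled by [K2]. *)
  apply: bounded_linear_continuous; apply/ex_bound.
  exists ((`|q0| + 64 * e 0%N / r)%:C)%C; apply/nbhs_ballP; exists 1 => //= w.
  rewrite -ball_normE /= sub0r normrN rnormE -[1]/((1%:C)%C) ltcR => w1.
  have w0 := rnorm_ge0 w.
  rewrite normc_norm lecR.
  have := ler_normcD (D 0%N w) (- (D 0%N w - L w)).
  rewrite normc_opp opprB addrC subrK => /le_trans; apply; apply: lerD.
    apply: le_trans (Dq w) _; apply: le_trans (ler_norm _) _.
    by rewrite normrM (ger0_norm w0) ler_piMr// ltW.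
  apply: le_trans (K2 0%N w) _.
  rewrite ger_pMr; first exact: ltW.
  by rewrite divr_gt0// mulr_gt0.
move=> d d0; have [dE d0'] := posC d0; set d' := complex.Re d in dE d0'.
(* One index serves both [K2] and [K3]; the remaining third is the linear approximation of [g N]. *)
have [N hN] := small 1 ler01 (d' / 3) (divr_gt0 d0' (ltr0n _ 3)).
have {}hN := hN N (leqnn N); rewrite mulr1 in hN.
have [q q1 hq] := Deps N (d' / 3) (divr_gt0 d0' (ltr0n _ 3)).
exists ((Num.min q (r / 8))%:C)%C; first by rewrite ltcR lt_min q1 divr_gt0.
move=> w; rewrite rnormE ltcR lt_min => /andP[wq wr].
have w0 := rnorm_ge0 w.
have h1 : normc (g N (x + w) - g N x - D N w) <= d' / 3 * rnorm w.
  exact: hq.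
have h2 := K3 N w (ltW wr); have h3 := K2 N w.
rewrite dE -rmorphM/= normc_norm lecR.
have -> : h (x + w) - h x - Lf w = (h (x + w) - g N (x + w) - (h x - g N x))
   + (g N (x + w) - g N x - D N w) + (D N w - L w) :> C.
  rewrite -[Lf w]/(L w); ring.
apply: le_trans (ler_normcD _ _) _.
have := ler_normcD (h (x + w) - g N (x + w) - (h x - g N x)) (g N (x + w) - g N x - D N w).
have : 64 * e N / r * rnorm w <= d' / 3 * rnorm w by rewrite ler_wpM2r.
lra.
Qed.

End Weierstrass.

(** * Orthogonal projection *)

Section InnerProduct.
Variables (R : realType) (V : lmodType R[i]) (H : set V) (ip : V -> V -> R[i]).
Local Notation C := R[i].
Hypothesis H0 : H 0.
Hypothesis HL : forall (a : C) F G, H F -> H G -> H (a *: F + G).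
Hypothesis ipL : forall (a : C) F G K, H F -> H G -> H K ->
  ip (a *: F + G) K = a * ip F K + ip G K.
Hypothesis ipC : forall F G, H F -> H G -> ip G F = (ip F G)^*.
Hypothesis ip_ge0 : forall F, H F -> 0 <= ip F F.
Hypothesis ip_eq0 : forall F, H F -> ip F F = 0 -> F = 0.
Hypothesis Hcomplete : forall u : nat -> V, (forall k, H (u k)) ->
  (forall eps : C, 0 < eps -> exists N, forall p q, (N <= p)%N -> (N <= q)%N ->
     ip (u p - u q) (u p - u q) < eps) ->
  exists L, H L /\ forall eps : C, 0 < eps -> exists N, forall p, (N <= p)%N ->
     ip (u p - L) (u p - L) < eps.

Lemma subspaceD F G : H F -> H G -> H (F + G).
Proof. by rewrite -{2}(scale1r F); exact: HL. Qed.

Lemma subspaceZ a F : H F -> H (a *: F).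
Proof. by rewrite -(addr0 (a *: F)) => h; exact: HL. Qed.

Lemma subspaceN F : H F -> H (- F).
Proof. by rewrite -scaleN1r; exact: subspaceZ. Qed.

Lemma subspaceB F G : H F -> H G -> H (F - G).
Proof. by move=> hF hG; exact/subspaceD/subspaceN. Qed.

Lemma subspace_sum k (F : 'I_k -> V) : (forall j, H (F j)) -> H (\sum_j F j).
Proof. by move=> hF; apply: (big_ind H) => // x y; exact: subspaceD. Qed.

Lemma ip0l K : H K -> ip 0 K = 0.
Proof.
move=> hK; have := ipL 1 H0 H0 hK; rewrite scale1r addr0 mul1r.
by move=> /eqP; rewrite -subr_eq subrr => /eqP.
Qed.

Lemma ipDl F G K : H F -> H G -> H K -> ip (F + G) K = ip F K + ip G K.
Proof. by move=> hF hG hK; rewrite -{1}(scale1r F) ipL// mul1r. Qed.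

Lemma ipZl a F K : H F -> H K -> ip (a *: F) K = a * ip F K.
Proof. by move=> hF hK; rewrite -{1}(addr0 (a *: F)) ipL// ip0l// addr0. Qed.

Lemma ipDr F G K : H F -> H G -> H K -> ip K (F + G) = ip K F + ip K G.
Proof.
by move=> hF hG hK; rewrite (ipC (subspaceD hF hG) hK) ipDl// rmorphD/= -!ipC.
Qed.

Lemma ipZr a F K : H F -> H K -> ip K (a *: F) = a^* * ip K F.
Proof. by move=> hF hK; rewrite (ipC (subspaceZ a hF) hK) ipZl// rmorphM/= -ipC. Qed.

Definition sqnorm F : R := complex.Re (ip F F).

Lemma sqnE F : H F -> ip F F = ((sqnorm F)%:C)%C.
Proof.
move=> /ip_ge0; rewrite /sqnorm; case: (ip F F) => a b.
by rewrite lecE /= => /andP[/eqP ->].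
Qed.

Lemma sqn_ge0 F : H F -> 0 <= sqnorm F.
Proof. by move=> hF; rewrite -lecR -sqnE//; exact: ip_ge0. Qed.

Lemma sqn_eq0 F : H F -> sqnorm F = 0 -> F = 0.
Proof. by move=> hF h; apply: ip_eq0 => //; rewrite sqnE// h. Qed.

Lemma sqnZ a F : H F -> sqnorm (a *: F) = normc a ^+ 2 * sqnorm F.
Proof.
move=> hF; apply: complexI; rewrite -sqnE ?ipZl ?ipZr//; last exact: subspaceZ.
  by rewrite rmorphM rmorphXn/= -normc_norm normCK mulrA -sqnE.
exact: subspaceZ.
Qed.

Lemma sqnN F : H F -> sqnorm (- F) = sqnorm F.
Proof. by move=> hF; rewrite -scaleN1r sqnZ// normc_opp normc1 expr1n mul1r. Qed.

Lemma sqnBC F G : H F -> H G -> sqnorm (F - G) = sqnorm (G - F).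
Proof. by move=> hF hG; rewrite -opprB sqnN//; exact: subspaceB. Qed.

Lemma sqnD F G : H F -> H G -> sqnorm (F + G) = sqnorm F + sqnorm G + 2 * complex.Re (ip F G).
Proof.
move=> hF hG; have hFG := subspaceD hF hG.
rewrite /sqnorm ipDl// !ipDr// (ipC hF hG).
by move: (ip F F) (ip G G) (ip F G) => [a b] [c d] [x y] /=; ring.
Qed.

Lemma parallelogram F G : H F -> H G -> sqnorm (F + G) + sqnorm (F - G) = 2 * sqnorm F + 2 * sqnorm G.
Proof.
move=> hF hG; rewrite !sqnD//; last exact: subspaceN.
rewrite sqnN// -scaleN1r ipZr// rmorphN1 mulN1r.
case: (ip F G) => x y /=; ring.
Qed.

Lemma sqnD_le F G : H F -> H G -> sqnorm (F + G) <= 2 * sqnorm F + 2 * sqnorm G.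
Proof.
move=> hF hG; rewrite -parallelogram// lerDl; apply: sqn_ge0; exact: subspaceB.
Qed.

Lemma sqnD_lt F G e : H F -> H G -> sqnorm F < e / 4 -> sqnorm G < e / 4 -> sqnorm (F + G) < e.
Proof. by move=> hF hG h1 h2; apply: le_lt_trans (sqnD_le hF hG) _; lra. Qed.

(** Expand the square of s F - G, which is nonnegative. A small [s] keeps the coefficient of
    [sqnorm F] close to 1, so limits can be taken with squared norms. *)
Lemma sqnD_weighted F G (s : R) : 0 < s -> H F -> H G ->
  sqnorm (F + G) <= (1 + s) * sqnorm F + (1 + s^-1) * sqnorm G.
Proof.
move=> s0 hF hG; rewrite sqnD//.
have /sqn_ge0 : H ((s%:C)%C *: F + - G) by apply: HL => //; exact: subspaceN.
rewrite sqnD; [|exact: subspaceZ|exact: subspaceN].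
rewrite sqnZ// sqnN// -scaleN1r ipZr//; last exact: subspaceZ.
rewrite rmorphN1 mulN1r ipZl// normc_real gtr0_norm//.
have -> : complex.Re (- ((s%:C)%C * ip F G)) = - (s * complex.Re (ip F G)).
  by case: (ip F G) => x y /=; rewrite mul0r subr0.
set X := complex.Re _ => h.
have : 2 * X <= s * sqnorm F + s^-1 * sqnorm G.
  rewrite -(ler_pM2l s0) mulrDr mulrA (mulrA s s^-1) divff ?gt_eqF// mul1r.
  move: h; rewrite expr2; lra.
lra.
Qed.

(** The classical argument: differences F - k of nearly minimal norm form a Cauchy sequence by the
    parallelogram law, their limit has minimal norm, and minimality against multiples of [r] forces
    orthogonality. *)
Lemma orthogonal_projection (K : set V) F :
  (forall k, K k -> H k) -> K 0 -> (forall a k l, K k -> K l -> K (a *: k + l)) ->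
  (forall G, H G -> (forall e : R, 0 < e -> exists2 k, K k & sqnorm (G - k) < e) -> K G) ->
  H F -> exists P, [/\ H P, K (F - P) & forall r, K r -> ip P r = 0].
Proof.
move=> KH K0 KL Kcl hF.
pose S : set R := [set sqnorm (F - k) | k in K].
have S0 : S !=set0 by exists (sqnorm (F - 0)), 0.
have Slb : lbound S 0 by move=> _ [k hk <-]; apply/sqn_ge0/subspaceB/KH.
pose d := inf S.
have dS k : K k -> d <= sqnorm (F - k) by move=> hk; apply: ge_inf; [exists 0|exists k].
have d0 : 0 <= d by apply: lb_le_inf.
have /choice[k hk] : forall j : nat, exists k, K k /\ sqnorm (F - k) < d + j.+1%:R^-1.
  move=> j; have Sinf : has_inf S by split=> //; exists 0.
  have e0 : 0 < j.+1%:R^-1 :> R by rewrite invr_gt0.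
  by have [_ [k hk <-] h] := inf_adherent e0 Sinf; exists k.
have kK j := (hk j).1; pose u j := F - k j.
have uH j : H (u j) by apply/subspaceB/KH.
have uS j : sqnorm (u j) < d + j.+1%:R^-1 := (hk j).2.
have uC p q : sqnorm (u p - u q) <= 2 * p.+1%:R^-1 + 2 * q.+1%:R^-1.
  have := parallelogram (uH p) (uH q); have := uS p; have := uS q.
  have : 4 * d <= sqnorm (u p + u q).
    (* The midpoint of [k p] and [k q] lies in [K], which bounds the sum term of the parallelogram
       law from below. *)
    have hm : K (2^-1 *: (k p + k q)).
      rewrite -[X in K X]addr0; apply: (KL) => //; rewrite -[k p]scale1r; exact: (KL).
    have -> : u p + u q = (2 : C) *: (F - 2^-1 *: (k p + k q)).
      rewrite scalerBr scalerA divff ?two_neq0// scale1r scaler_nat mulr2n /u.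
      by rewrite opprD addrACA.
    rewrite sqnZ; last exact/subspaceB/KH.
    have -> : normc (2 : C) = 2.
      by rewrite -[2 : C](rmorph_nat (real_complex R)) normc_real ger0_norm.
    have := dS _ hm; lra.
  by move: (p.+1%:R^-1) (q.+1%:R^-1) => ep eq; lra.
have [||L [hL uL]] := Hcomplete (u := u) => //.
  move=> eps /posC[-> e0]; set e := complex.Re eps in e0 *.
  have [|N hN] := @natSinv_small R (e / 5); first by lra.
  exists N => p q /hN hp /hN hq; rewrite sqnE ?ltcR; last exact: subspaceB.
  apply: le_lt_trans (uC p q) _.
  by move: (p.+1%:R^-1) (q.+1%:R^-1) hp hq => ep eq hp hq; lra.
have {}uL (e : R) : 0 < e -> exists N, forall p, (N <= p)%N -> sqnorm (u p - L) < e.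
  move=> e0; have [|N hN] := uL (e%:C)%C; first by rewrite ltcR.
  by exists N => p /hN; rewrite sqnE ?ltcR//; exact: subspaceB.
have KFL : K (F - L).
  apply: Kcl; first exact: subspaceB.
  move=> e /uL[N hN]; exists (k N) => //.
  by have := hN N (leqnn N); rewrite /u addrAC.
have Lmin r : K r -> sqnorm L <= sqnorm (L - r).
  move=> hr; apply: (@le_trans _ _ d); last first.
    have -> : L - r = F - (r + (F - L)) by rewrite opprD opprB addrCA [F + _]addrC subrK addrC.
    by apply: dS; rewrite -[r]scale1r; apply: (KL).
  apply/ler_addgt0Pl => e e0.
  (* Makes [s * d] at most [e / 2]; the errors from [h1] and [h2] take [e / 4] each. *)
  pose s := e / (2 * (d + 1)).
  have s0 : 0 < s by rewrite divr_gt0//; lra.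
  have si0 : 0 < s^-1 by rewrite invr_gt0.
  have [|N1 h1] := @natSinv_small R (e / 4 / (1 + s)); first by rewrite divr_gt0//; lra.
  have [|N2 h2] := uL (e / 4 / (1 + s^-1)); first by rewrite divr_gt0//; lra.
  pose p := (N1 + N2)%N; have {}h1 := h1 p (leq_addr _ _); have {}h2 := h2 p (leq_addl _ _).
  have -> : L = u p + (L - u p) by rewrite addrC subrK.
  apply: le_trans (sqnD_weighted s0 (uH p) _) _; first exact: subspaceB.
  rewrite sqnBC//.
  move: h1; rewrite ler_pdivlMr; last by lra.
  move: h2; rewrite ltr_pdivlMr; last by lra.
  have : (1 + s) * sqnorm (u p) <= (1 + s) * (d + p.+1%:R^-1).
    by rewrite ler_pM2l; [exact/ltW/uS|lra].
  have : s * d <= e / 2.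
    by rewrite /s mulrAC ler_pdivrMr; [nra|lra].
  move: (p.+1%:R^-1) => ep; lra.
exists L; split => // r hr; have rH := KH r hr.
have [r0|rn0] := eqVneq (sqnorm r) 0.
  by rewrite (sqn_eq0 rH r0) (ipC H0 hL) ip0l// conjC0.
have rp : 0 < sqnorm r by rewrite lt_def rn0 sqn_ge0.
(* The multiple [t *: r] is the projection of [L] on [r]; subtracting it lowers the squared norm by
   |c|^2 / [sqnorm r], so minimality gives [c = 0]. *)
pose c := ip L r; pose t := c * ((sqnorm r)^-1%:C)%C.
have tr : K (t *: r) by rewrite -[X in K X]addr0; apply: (KL).
have := Lmin _ tr; rewrite sqnD//; last exact/subspaceN/KH.
rewrite sqnN ?sqnZ//; last exact: KH.
rewrite -scaleNr ipZr// -/c.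
have -> : (- t)^* * c = - ((normc c ^+ 2 / sqnorm r)%:C)%C.
  have -> : (- t)^* = - (c^* * ((sqnorm r)^-1%:C)%C).
    rewrite /t rmorphN rmorphM/=; congr (- (_ * _)).
    by apply: CrealP; rewrite complex_real.
  by rewrite mulNr mulrAC -normCKC normc_norm -rmorphXn -rmorphM.
rewrite /t normcM normc_real gtr0_norm ?invr_gt0//= => h.
have h2 : normc c ^+ 2 / sqnorm r <= 0.
  have e1 : (normc c / sqnorm r) ^+ 2 * sqnorm r = normc c ^+ 2 / sqnorm r by field.
  rewrite e1 in h; lra.
have : normc c ^+ 2 <= 0 by rewrite -(ler_pM2r (x := (sqnorm r)^-1)) ?invr_gt0// mul0r.
by rewrite exprn_even_le0//= => /eqP/eq0_normc.
Qed.

End InnerProduct.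

(** * Quasi-free modules *)

Section AlgebraElements.
Variables (R : realType) (n m : nat) (Om : set (Cn R n)).
Local Notation C := R[i].

Lemma A_alg_cst (c : C) : A_alg Om (fun _ => c).
Proof.
move=> eps e0; exists setT, (cst (c : CC R)); split => //.
- exact: openT.
- by move=> z _; rewrite subrr normr0.
Qed.

Lemma combE (f : 'I_m -> Fn R n m) c z :
  comb f c z = (\matrix_(i, j) f j z i 0) *m c.
Proof.
rewrite /comb fct_sumE; apply/colP => i; rewrite mxE summxE.
by apply: eq_bigr => j _; rewrite !mxE mulrC.
Qed.

Lemma comb_linear (f : 'I_m -> Fn R n m) a c d :
  comb f (a *: c + d) = a *: comb f c + comb f d.
Proof.
rewrite /comb scaler_sumr -big_split; apply: eq_bigr => j _.
by rewrite !mxE scalerDl scalerA.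
Qed.

End AlgebraElements.

Section QuasiFreeModule.
Variables (R : realType) (n m : nat) (Om : set (Cn R n)).
Variables (H : set (Fn R n m)) (ip : Fn R n m -> Fn R n m -> R[i]).
Local Notation C := R[i].
Hypothesis QF : quasi_free Om H ip.

Let H0 : H 0. Proof. by case: QF => [[]]. Qed.
Let HL : forall (a : C) F G, H F -> H G -> H (a *: F + G).
Proof. by case: QF => [[]]. Qed.
Let ipL : forall (a : C) F G K, H F -> H G -> H K ->
  ip (a *: F + G) K = a * ip F K + ip G K.
Proof. by case: QF => _ [_ []]. Qed.
Let ipC : forall F G, H F -> H G -> ip G F = (ip F G)^*.
Proof. by case: QF => _ [_ [_ []]]. Qed.
Let ip_ge0 : forall F, H F -> 0 <= ip F F.
Proof. by case: QF => _ [_ [_ [_ []]]]. Qed.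
Let ip_eq0 : forall F, H F -> ip F F = 0 -> F = 0.
Proof. by case: QF => _ [_ [_ [_ [_ []]]]]. Qed.
Let Hcomplete := proj1 (proj2 (proj2 (proj2 (proj2 (proj2 (proj2 QF)))))).
Let Hdense : forall F, H F -> forall eps : C, 0 < eps ->
  exists G, alg_tensor Om G /\ ip (F - G) (F - G) < eps.
Proof. by case: QF => _ [_ [_ [_ [_ [_ [_ [_ []]]]]]]]. Qed.
Let Htensor : forall F, alg_tensor Om F -> H F.
Proof. by case: QF => _ [_ [_ [_ [_ [_ [_ []]]]]]]. Qed.
Let Heval : forall z, Om z -> exists M : C, \forall w \near z,
         forall F, H F -> l2sq (F w) <= M * ip F F.
Proof. by case: QF => _ [_ [_ [_ [_ [_ [_ [_ [_ []]]]]]]]]. Qed.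
Let HmulA phi F : A_alg Om phi -> H F -> H (mulA phi F).
Proof.
by move=> hp hF; case: QF => _ [_ [_ [_ [_ [_ [_ [_ [_ [_ /(_ _ _ hp hF) []]]]]]]]]].
Qed.

Local Notation sqn := (sqnorm ip).
Local Notation subspaceB := (subspaceB H0 HL).
Local Notation subspaceZ := (subspaceZ H0 HL).
Local Notation subspaceD := (subspaceD HL).
Local Notation sqnE := (sqnE ip_ge0).

Lemma quasi_free_sub F G : H F -> H G -> H (F - G). Proof. exact: subspaceB. Qed.

Lemma ip_lt F (e : R) : H F -> (ip F F < (e%:C)%C) = (sqn F < e).
Proof. by move=> hF; rewrite sqnE// ltcR. Qed.

Lemma quasi_free_ip00 : ip 0 0 = 0. Proof. exact: (ip0l H0 ipL H0). Qed.

Lemma quasi_free_definite F : H F -> ip F F = 0 -> F = 0.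
Proof. exact: ip_eq0. Qed.

Lemma quasi_free_comb f c : (forall i, H (f i)) -> H (comb f c).
Proof. by move=> hf; apply: (subspace_sum H0 HL) => j; exact: subspaceZ. Qed.

Lemma quasi_free_mulA phi F : A_alg Om phi -> H F -> H (mulA phi F).
Proof. exact: HmulA. Qed.

(** The algebraic submodule whose closure is [Rz]. *)
Definition ideal_span (z : Cn R n) (F : Fn R n m) : Prop :=
  exists k (phi : 'I_k -> Cn R n -> C) (h : 'I_k -> Fn R n m),
    (forall j, [/\ A_alg Om (phi j), phi j z = 0 & H (h j)]) /\
    F = \sum_(j < k) mulA (phi j) (h j).

Lemma ideal_span_sub z F : ideal_span z F -> H F.
Proof.
move=> [k [phi [h [hj ->]]]]; apply: (subspace_sum H0 HL) => j.
by have [? _ ?] := hj j; exact: HmulA.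
Qed.

Lemma ideal_span0 z : ideal_span z 0.
Proof.
exists 0%N, (fun _ _ => 0), (fun _ => 0); split; first by case.
by rewrite big_ord0.
Qed.

Lemma ideal_span_linear z a F G :
  ideal_span z F -> ideal_span z G -> ideal_span z (a *: F + G).
Proof.
move=> [k [phi [h [hj ->]]]] [k' [phi' [h' [hj' ->]]]].
exists (k + k')%N.
exists (fun j => match fintype.split j with inl i => phi i | inr i => phi' i end).
exists (fun j => match fintype.split j with inl i => a *: h i | inr i => h' i end).
split.
  move=> j; case: (fintype.split j) => i; last exact: hj'.
  by have [? ? ?] := hj i; split => //; exact: subspaceZ.
rewrite big_split_ord scaler_sumr; congr (_ + _); apply: eq_bigr => j _.
  rewrite (unsplitK (inl j)).
  by apply/funext => w; rewrite -[LHS]/(a *: (phi j w *: h j w))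
    -[RHS]/(phi j w *: (a *: h j w)) !scalerA mulrC.
by rewrite (unsplitK (inr j)).
Qed.

Lemma ideal_span_eval z F : ideal_span z F -> F z = 0.
Proof.
move=> [k [phi [h [hj ->]]]]; rewrite fct_sumE big1// => j _.
by have [_ p0 _] := hj j; rewrite /mulA p0 scale0r.
Qed.

Lemma RzP z F : Rz Om H ip z F <->
  H F /\ forall e : R, 0 < e -> exists2 S, ideal_span z S & sqn (F - S) < e.
Proof.
split=> [[hF h]|[hF h]]; split => //.
  move=> e e0; have [|k [phi [g [hj hlt]]]] := h (e%:C)%C; first by rewrite ltcR.
  have sp : ideal_span z (\sum_(j < k) mulA (phi j) (g j)) by exists k, phi, g.
  exists (\sum_(j < k) mulA (phi j) (g j)) => //.
  by rewrite -ip_lt//; apply: subspaceB => //; exact: (ideal_span_sub sp).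
move=> e /posC[-> e0]; have [S sp hlt] := h _ e0.
have sH := ideal_span_sub sp; case: sp => k [phi [g [hj SE]]].
by exists k, phi, g; split => //; rewrite -SE ip_lt//; exact: subspaceB.
Qed.

Lemma Rz_sub z F : Rz Om H ip z F -> H F. Proof. by case. Qed.

Lemma Rz0 z : Rz Om H ip z 0.
Proof.
apply/RzP; split => // e e0; exists 0; first exact: ideal_span0.
by rewrite subr0 /sqnorm quasi_free_ip00.
Qed.

Lemma Rz_closed z F : H F ->
  (forall e : R, 0 < e -> exists2 G, Rz Om H ip z G & sqn (F - G) < e) ->
  Rz Om H ip z F.
Proof.
move=> hF h; apply/RzP; split => // e e0.
have e4 : 0 < e / 4 by lra.
have [G /RzP[hG /(_ _ e4)[S sp hS]] hlt] := h _ e4.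
exists S => //; have sH := ideal_span_sub sp.
have -> : F - S = (F - G) + (G - S) by rewrite addrA subrK.
by apply: (sqnD_lt H0 HL ipL ipC ip_ge0) => //; exact: subspaceB.
Qed.

Lemma Rz_linear z a F G : Rz Om H ip z F -> Rz Om H ip z G -> Rz Om H ip z (a *: F + G).
Proof.
move=> /RzP[hF hF'] /RzP[hG hG']; apply/RzP; split; first exact: HL.
move=> e e0; have e4 : 0 < e / 4 by lra.
have n1 : 0 < normc a ^+ 2 + 1 by rewrite ltr_wpDl ?sqr_ge0.
have [|S sp hS] := hF' (e / 4 / (normc a ^+ 2 + 1)); first by rewrite divr_gt0.
have [T tp hT] := hG' _ e4.
exists (a *: S + T); first exact: ideal_span_linear.
have sH := ideal_span_sub sp; have tH := ideal_span_sub tp.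
have -> : a *: F + G - (a *: S + T) = a *: (F - S) + (G - T).
  by rewrite opprD addrACA -scalerBr.
have FS := subspaceB hF sH; have GT := subspaceB hG tH.
apply: (sqnD_lt H0 HL ipL ipC ip_ge0) => //; first exact: subspaceZ.
rewrite (sqnZ H0 HL ipL ipC ip_ge0)//.
move: hS; rewrite ltr_pdivlMr// => hS; apply: le_lt_trans hS.
by rewrite mulrC ler_wpM2l ?(sqn_ge0 ip_ge0)// lerDl.
Qed.

Lemma RzB z F G : Rz Om H ip z F -> Rz Om H ip z G -> Rz Om H ip z (F - G).
Proof. by move=> hF hG; rewrite addrC -scaleN1r; exact: Rz_linear. Qed.

Lemma perp_part_exists z F : H F -> exists P, perp_part Om H ip z F P.
Proof.
move=> hF; apply: (orthogonal_projection H0 HL ipL ipC ip_ge0 ip_eq0 Hcomplete) => //.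
- by move=> k; exact: Rz_sub.
- exact: Rz0.
- by move=> a k l; exact: Rz_linear.
- by move=> G; exact: Rz_closed.
Qed.

(** [P - Q] lies in [Rz] and is orthogonal to it. Allowing two representatives shows that the
    orthogonal part depends only on the class modulo [Rz]. *)
Lemma perp_part_unique z F G P Q : Rz Om H ip z (F - G) ->
  perp_part Om H ip z F P -> perp_part Om H ip z G Q -> P = Q.
Proof.
move=> FG [hP rP oP] [hQ rQ oQ].
have PQ : Rz Om H ip z (P - Q).
  have -> : P - Q = (F - G) - (F - P) + (G - Q).
    by rewrite opprB [F - G + _]addrC !addrA !subrK.
  rewrite -[X in _ (X + _)]scale1r; apply: Rz_linear => //; exact: RzB.
apply/eqP; rewrite -subr_eq0; apply/eqP/ip_eq0; first exact: subspaceB.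
have hPQ := subspaceB hP hQ.
have E : P - Q = -1 *: Q + P by rewrite scaleN1r addrC.
by rewrite [X in ip X _]E ipL// oP// oQ// mulr0 addr0.
Qed.

Lemma qprojP z F : H F -> perp_part Om H ip z F (qproj Om H ip z F).
Proof. by move=> hF; apply: epsilon_spec; exact: perp_part_exists. Qed.

Lemma qproj_eq z F P : H F -> perp_part Om H ip z F P -> qproj Om H ip z F = P.
Proof.
move=> hF hP; apply: (perp_part_unique _ (qprojP z hF) hP).
by rewrite subrr; exact: Rz0.
Qed.

Lemma qproj_mod z F G : H F -> H G -> Rz Om H ip z (F - G) ->
  qproj Om H ip z F = qproj Om H ip z G.
Proof. by move=> hF hG FG; exact: (perp_part_unique FG (qprojP z hF) (qprojP z hG)). Qed.

Lemma l2sq_entry (v : 'cV[C]_m) i : ((normc (v i 0) ^+ 2)%:C)%C <= l2sq v.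
Proof.
rewrite /l2sq (bigD1 i)//= normc_norm -rmorphXn lerDl.
by apply: sumr_ge0 => j _; rewrite exprn_ge0.
Qed.

Lemma eval_bound z : Om z -> exists (M r : R), [/\ 0 <= M, 0 < r &
  forall w, rnorm (w - z) < r -> forall F, H F -> forall i,
    normc (F w i 0) ^+ 2 <= M * sqn F].
Proof.
move=> /Heval[M /nbhs_ballP[r /= r0 hr]]; have [rE r0'] := posC r0.
exists (normc M), (complex.Re r); split => //; first exact: normc_ge0.
move=> w wz F hF i; rewrite -lecR; apply: le_trans (l2sq_entry _ _) _.
have bw : ball z r w.
  by rewrite -ball_normE /= distrC rE rnormE ltcR.
have h := hr w bw F hF.
have h0 : 0 <= M * ip F F.
  by apply: le_trans h; apply: sumr_ge0 => j _; rewrite exprn_ge0.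
apply: le_trans h _; rewrite -(ger0_norm h0) normrM (ger0_norm (ip_ge0 hF)).
by rewrite rmorphM/= sqnE// normc_norm.
Qed.

(** Evaluation at [z] is bounded and kills [ideal_span], hence also its closure. *)
Lemma Rz_eval z F : Om z -> Rz Om H ip z F -> F z = 0.
Proof.
move=> /eval_bound[M [r [M0 r0 h]]] /RzP[hF hS]; apply/colP => i; rewrite mxE.
have zz : rnorm (z - z) < r by rewrite subrr /rnorm normr0.
apply/eq0_normc/eqP; rewrite -sqrf_eq0 eq_le sqr_ge0 andbT.
apply/ler_addgt0Pl => e e0; rewrite addr0.
have M1 : 0 < M + 1 by lra.
have [|S sp hlt] := hS (e / (M + 1)); first by rewrite divr_gt0.
have hFS := subspaceB hF (ideal_span_sub sp).
have := h z zz _ hFS i.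
rewrite -[(F - S) z]/(F z - S z) (ideal_span_eval sp) subr0 => /le_trans; apply.
move: hlt; rewrite ltr_pdivlMr// => hlt.
have := sqn_ge0 ip_ge0 hFS; lra.
Qed.

(** Makes evaluation at each point of [Om] surjective; the function is cut off outside [Om], as
    membership in [H] demands. *)
Lemma quasi_free_const (v : 'cV[C]_m) :
  exists2 F, H F & forall z, Om z -> F z = v.
Proof.
pose F : Fn R n m := fun z => if `[< Om z >] then v else 0.
exists F; last by move=> z hz; rewrite /F asboolT.
apply: Htensor; exists 1%N, (fun _ _ => 1), (fun _ => v); split.
  by move=> _; exact: A_alg_cst.
move=> z; split => hz; rewrite /F; last by rewrite asboolF.
by rewrite asboolT// big_ord1 scale1r.
Qed.

(** Density gives approximation in norm by tensors, which is locally uniform by [eval_bound]; their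
    coefficients are uniform limits of functions holomorphic near the closure of [Om]. Weierstrass's
    theorem then applies. *)
Lemma quasi_free_holomorphic F i z : open Om -> H F -> Om z ->
  differentiable ((fun w => F w i 0) : Cn R n -> CC R) z.
Proof.
move=> oOm hF hz; have [M [r [M0 r0 hM]]] := eval_bound hz.
have /nbhs_ballP[r1 /= r10 hr1] : nbhs z Om by apply: open_nbhs_nbhs.
have [r1E r10'] := posC r10.
apply: (@differentiable_uniform_limit _ _ _ _ (Num.min r (complex.Re r1))); first by rewrite lt_min r0.
move=> e e0; have M1 : 0 < M + 1 by lra.
have e2 : 0 < (e / 2) ^+ 2 by rewrite exprn_gt0// divr_gt0.
(* After multiplication by the evaluation constant [M] the squared error is at most [(e / 2) ^+ 2];
   the other [e / 2] goes to the coefficients, through [d]. *)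
have [|G [tG hG]] := Hdense hF (eps := (((e / 2) ^+ 2 / (M + 1))%:C)%C).
  by rewrite ltcR divr_gt0.
have GH := Htensor tG; have FG := subspaceB hF GH.
rewrite ip_lt// ltr_pdivlMr// in hG.
case: tG => k [phi [v [hphi GE]]].
pose d : R := e / 2 / (\sum_(j < k) normc (v j i 0) + 1).
have s0 : 0 <= \sum_(j < k) normc (v j i 0) by apply: sumr_ge0 => j _; exact: normc_ge0.
have d0 : 0 < d by rewrite !divr_gt0//; lra.
have /choice[g hg] : forall j, exists g : Cn R n -> CC R,
   forall w, Om w -> differentiable g w /\ normc (phi j w - g w) <= d.
  move=> j; have [|U [g [_ cU dg hg]]] := hphi j (d%:C)%C; first by rewrite ltcR.
  exists g => w hw; split; first by apply/dg/cU/subset_closure.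
  by rewrite -lecR; apply: ltW; exact: hg.
exists (fun w => \sum_(j < k) g j w * v j i 0 : C) => w.
rewrite lt_min => /andP[wr wr1].
have hw : Om w by apply: hr1; rewrite -ball_normE /= distrC r1E rnormE ltcR.
split.
  have -> : ((fun w => \sum_(j < k) g j w * v j i 0 : C) : Cn R n -> CC R) =
     \sum_(j < k) ((v j i 0 : C) *: (g j : Cn R n -> CC R)).
    apply/funext => y; rewrite fct_sumE; apply: eq_bigr => j _.
    by rewrite mulrC.
  by apply: differentiable_sum => j; apply: differentiableZ; case: (hg j w hw).
have h1 : normc (F w i 0 - G w i 0) <= e / 2.
  rewrite -(@ler_pXn2r _ 2)// ?nnegrE ?normc_ge0//; last by rewrite divr_ge0// ltW.
  have := hM w wr _ FG i; rewrite -[(F - G) w]/(F w - G w) !mxE => /le_trans; apply.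
  have := sqn_ge0 ip_ge0 FG; lra.
have h2 : normc (G w i 0 - \sum_(j < k) g j w * v j i 0) <= e / 2.
  rewrite (GE w).1// summxE -sumrB.
  apply: (@le_trans _ _ (\sum_(j < k) d * normc (v j i 0))).
    elim/big_ind2: _ => [|a b a' b' h h'|j _]; first by rewrite normc0.
      by apply: le_trans (ler_normcD _ _) _; exact: lerD.
    rewrite mxE -mulrBl normcM ler_wpM2r ?normc_ge0//.
    by case: (hg j w hw).
  rewrite -mulr_sumr /d mulrAC ler_pdivrMr; last by lra.
  by rewrite ler_pM2l ?divr_gt0//; lra.
have := ler_normcD (F w i 0 - G w i 0) (G w i 0 - \sum_(j < k) g j w * v j i 0).
rewrite addrA subrK; lra.
Qed.

End QuasiFreeModule.

(** * Unitary equivalence *)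

Section ModuleUnitary.
Variables (R : realType) (n m : nat) (Om : set (Cn R n)).
Local Notation C := R[i].
Implicit Types (H : set (Fn R n m)) (ip : Fn R n m -> Fn R n m -> C).

(** The conditions in [unitarily_equivalent] with the map exposed, so that they can be applied to
    the inverse as well. *)
Definition module_unitary H ip H' ip' (U : Fn R n m -> Fn R n m) :=
  [/\ forall F, H F -> H' (U F),
      forall F', H' F' -> exists F, H F /\ U F = F',
      forall (a : C) F G, H F -> H G -> U (a *: F + G) = a *: U F + U G,
      forall F G, H F -> H G -> ip' (U F) (U G) = ip F G
    & forall phi F, A_alg Om phi -> H F -> U (mulA phi F) = mulA phi (U F)].

Section Properties.
Variables (H H' : set (Fn R n m)) (ip ip' : Fn R n m -> Fn R n m -> C).
Variable U : Fn R n m -> Fn R n m.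
Hypothesis QF : quasi_free Om H ip.
Hypothesis QF' : quasi_free Om H' ip'.
Hypothesis UU : module_unitary H ip H' ip' U.

Let H0 : H 0. Proof. by case: QF => [[]]. Qed.
Let HL : forall (a : C) F G, H F -> H G -> H (a *: F + G).
Proof. by case: QF => [[]]. Qed.
Let UH F : H F -> H' (U F). Proof. by case: UU => + _ _ _ _; exact. Qed.
Let UL a F G : H F -> H G -> U (a *: F + G) = a *: U F + U G.
Proof. by case: UU => _ _ + _ _; exact. Qed.
Let Uip F G : H F -> H G -> ip' (U F) (U G) = ip F G.
Proof. by case: UU => _ _ _ + _; exact. Qed.

Lemma module_unitary0 : U 0 = 0.
Proof.
have := UL 1 H0 H0; rewrite !scale1r addr0 => /eqP.
by rewrite -subr_eq subrr => /eqP.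
Qed.

Lemma module_unitaryB F G : H F -> H G -> U (F - G) = U F - U G.
Proof. by move=> hF hG; rewrite addrC -scaleN1r UL// scaleN1r addrC. Qed.

Lemma module_unitary_sum k (F : 'I_k -> Fn R n m) :
  (forall j, H (F j)) -> U (\sum_j F j) = \sum_j U (F j).
Proof.
elim: k F => [|k IH] F hF; first by rewrite !big_ord0 module_unitary0.
rewrite !big_ord_recl -[F ord0]scale1r UL//; last exact: (subspace_sum H0 HL).
by rewrite !scale1r IH.
Qed.

Lemma module_unitary_inj F G : H F -> H G -> U F = U G -> F = G.
Proof.
move=> hF hG FG; have hFG := quasi_free_sub QF hF hG.
apply/eqP; rewrite -subr_eq0; apply/eqP/(quasi_free_definite QF hFG).
by rewrite -Uip// module_unitaryB// FG subrr (quasi_free_ip00 QF').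
Qed.

Lemma module_unitary_ideal_span z F :
  ideal_span Om H z F -> ideal_span Om H' z (U F).
Proof.
move=> [k [phi [h [hj ->]]]]; exists k, phi, (fun j => U (h j)); split.
  by move=> j; have [? ? ?] := hj j; split => //; exact: UH.
rewrite module_unitary_sum; last first.
  by move=> j; have [? _ ?] := hj j; apply: (quasi_free_mulA QF).
apply: eq_bigr => j _; have [? _ ?] := hj j.
by case: UU => _ _ _ _; apply.
Qed.

(** [U] commutes with multiplication, so it preserves [ideal_span] with the same multipliers, and
    being isometric it preserves closures. *)
Lemma module_unitary_Rz z F : Rz Om H ip z F -> Rz Om H' ip' z (U F).
Proof.
move=> /(RzP QF)[hF h]; apply/(RzP QF'); split; first exact: UH.
move=> e /h[S sp hS]; exists (U S); first exact: module_unitary_ideal_span.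
have hFS := quasi_free_sub QF hF (ideal_span_sub QF sp).
by rewrite /sqnorm -module_unitaryB ?Uip//; exact: (ideal_span_sub QF sp).
Qed.

Lemma module_unitary_comb (f : 'I_m -> Fn R n m) c :
  (forall i, H (f i)) -> U (comb f c) = comb (fun i => U (f i)) c.
Proof.
move=> hf; rewrite /comb module_unitary_sum => [|j]; last exact: (subspaceZ H0 HL).
apply: eq_bigr => j _; rewrite -[X in U X]addr0 UL// module_unitary0 addr0//.
Qed.

End Properties.

Lemma module_unitary_inv H ip H' ip' U : quasi_free Om H ip -> quasi_free Om H' ip' ->
  module_unitary H ip H' ip' U ->
  exists W, module_unitary H' ip' H ip W /\ (forall F', H' F' -> U (W F') = F') /\
            (forall F, H F -> W (U F) = F).
Proof.
move=> QF QF' UU; have [UH Us UL Uip UM] := UU.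
have Uinj := module_unitary_inj QF QF' UU.
have /choice[W hW] : forall F', exists F, H' F' -> H F /\ U F = F'.
  (* Outside [H'] the requirement is vacuous, and 0 is offered as a default. *)
  move=> F'; have [/Us[F hF]|h] := pselect (H' F'); first by exists F.
  by exists 0 => /h.
have WH F' (h : H' F') : H (W F') := (hW F' h).1.
have UW F' (h : H' F') : U (W F') = F' := (hW F' h).2.
have [HL HL'] : (forall (a : C) F G, H F -> H G -> H (a *: F + G)) /\
    (forall (a : C) F G, H' F -> H' G -> H' (a *: F + G)).
  by split; [case: QF => [[]]|case: QF' => [[]]].
exists W; split; last first.
  by split => // F hF; apply: Uinj; rewrite ?UW//; [apply: WH|]; exact: UH.
split => //.
- move=> F hF; exists (U F); split; first exact: UH.
  by apply: Uinj; rewrite ?UW//; [apply: WH|]; exact: UH.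
- move=> a F G hF hG; have hFG := HL' a F G hF hG.
  apply: Uinj; [exact: WH|by apply: HL; exact: WH|].
  by rewrite UL ?UW//; exact: WH.
- by move=> F G hF hG; rewrite -Uip ?UW//; exact: WH.
- move=> phi F hp hF; have hpF := quasi_free_mulA QF' hp hF.
  apply: Uinj; [exact: WH|by apply: (quasi_free_mulA QF) => //; exact: WH|].
  by rewrite UM ?UW//; exact: WH.
Qed.

(** [U] carries the orthogonal decomposition modulo [Rz] to the one in [H']. Orthogonality to all of
    the target [Rz] uses the inverse map, which brings its elements back. *)
Lemma module_unitary_qproj H ip H' ip' U z F : quasi_free Om H ip -> quasi_free Om H' ip' ->
  module_unitary H ip H' ip' U -> H F ->
  qproj Om H' ip' z (U F) = U (qproj Om H ip z F).
Proof.
move=> QF QF' UU hF; have [UH _ _ Uip _] := UU.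
have [W [WW [UW WU]]] := module_unitary_inv QF QF' UU.
have [hP rP oP] := qprojP QF z hF.
apply: (qproj_eq QF'); first exact: UH.
split; first exact: UH.
  by rewrite -(module_unitaryB UU)//; apply: (module_unitary_Rz QF QF' UU).
move=> r hr; have rH := Rz_sub hr.
have hWr := module_unitary_Rz QF' QF WW hr.
by rewrite -(UW r rH) Uip ?oP//; exact: Rz_sub hWr.
Qed.

End ModuleUnitary.

(** * Holomorphy of determinants and inverse matrices *)

Section Determinant.
Variables (R : realType) (V : normedModType R[i]).
Local Notation C := R[i].

Lemma differentiable_prod_seq (I : Type) (s : seq I) (P : pred I) (f : I -> V -> CC R) z :
  (forall i, differentiable (f i) z) ->
  differentiable ((fun w => \prod_(i <- s | P i) (f i w : C)) : V -> CC R) z.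
Proof.
move=> fz; elim: s => [|i s IH].
  rewrite (_ : (fun _ => _) = cst (1 : CC R)); first exact: differentiable_cst.
  by apply/funext => w; rewrite big_nil.
case: (boolP (P i)) => Pi.
  rewrite (_ : (fun _ => _) = fun w => (f i w : C) * \prod_(j <- s | P j) (f j w : C)).
    exact: (@differentiableM C _ _ _ z (fz i) IH).
  by apply/funext => w; rewrite big_cons Pi.
rewrite (_ : (fun _ => _) = fun w => \prod_(j <- s | P j) (f j w : C))//.
by apply/funext => w; rewrite big_cons (negbTE Pi).
Qed.

Lemma differentiable_sum_seq (I : Type) (s : seq I) (P : pred I) (f : I -> V -> CC R) z :
  (forall i, differentiable (f i) z) ->
  differentiable ((fun w => \sum_(i <- s | P i) (f i w : C)) : V -> CC R) z.
Proof.
move=> fz; elim: s => [|i s IH].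
  rewrite (_ : (fun _ => _) = cst (0 : CC R)); first exact: differentiable_cst.
  by apply/funext => w; rewrite big_nil.
case: (boolP (P i)) => Pi.
  rewrite (_ : (fun _ => _) = fun w => (f i w : C) + \sum_(j <- s | P j) (f j w : C)).
    exact: (differentiableD (fz i) IH).
  by apply/funext => w; rewrite big_cons Pi.
rewrite (_ : (fun _ => _) = fun w => \sum_(j <- s | P j) (f j w : C))//.
by apply/funext => w; rewrite big_cons (negbTE Pi).
Qed.

Lemma differentiable_mul_cst (a : C) (f : V -> CC R) z :
  differentiable f z -> differentiable ((fun w => a * (f w : C)) : V -> CC R) z.
Proof. by move=> fz; exact: (differentiableZ a fz). Qed.

Lemma differentiable_det k (A : V -> 'M[C]_k) z :
  (forall i j, differentiable ((fun w => A w i j) : V -> CC R) z) ->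
  differentiable ((fun w => \det (A w)) : V -> CC R) z.
Proof.
move=> Az; rewrite /determinant.
apply: (@differentiable_sum_seq _ _ _
  (fun s w => (-1) ^+ (perm.odd_perm s) * \prod_i A w i (perm.fun_of_perm s i))) => s.
by apply: differentiable_mul_cst; apply: differentiable_prod_seq => i; exact: Az.
Qed.

(** Cramer's formula is used in place of [invmx], which is defined by cases on invertibility; its
    entries are determinants divided by a nonvanishing determinant. *)
Lemma differentiable_invmx k (A : V -> 'M[C]_k) z : A z \in unitmx ->
  (forall i j, differentiable ((fun w => A w i j) : V -> CC R) z) ->
  forall i j, differentiable ((fun w => (\det (A w))^-1 * \adj (A w) i j) : V -> CC R) z.
Proof.
move=> Au Az i j.
have dz := differentiable_det Az.
have d0 : \det (A z) != 0 by rewrite -unitfE -unitmxE.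
have dV := @differentiableV C _ _ z dz d0.
apply: (@differentiableM C _ _ _ z dV).
rewrite (_ : (fun _ => _) = fun w => (-1) ^+ (j + i) * \det (row' j (col' i (A w)))).
  apply: differentiable_mul_cst; apply: differentiable_det => i' j'.
  rewrite (_ : (fun _ => _) = fun w => A w (lift j i') (lift i j')); first exact: Az.
  by apply/funext => w; rewrite !mxE.
by apply/funext => w; rewrite mxE.
Qed.

End Determinant.

(** Preimages of the standard basis vectors are the columns of a right inverse. *)
Lemma surjective_unitmx (K : fieldType) k (A : 'M[K]_k) :
  (forall v : 'cV_k, exists c, A *m c = v) -> A \in unitmx.
Proof.
move=> /choice[c hc].
have : A *m (\matrix_(i, j) c (delta_mx j 0) i 0) = 1%:M.
  apply/matrixP => i j.
  have /(congr1 (fun v : 'cV_k => v i 0)) := hc (delta_mx j 0).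
  rewrite !mxE eqxx andbT => <-.
  by apply: eq_bigr => l _; rewrite mxE.
by move=> /mulmx1_unit[].
Qed.

(** * The holomorphic matrix representing the modulus *)

Theorem theorem4 (R : realType) (n m : nat) (Om : set (Cn R n))
  (H H' : set (Fn R n m)) (ip ip' : Fn R n m -> Fn R n m -> R[i])
  (f g : 'I_m -> Fn R n m) :
  bounded_domain Om ->
  quasi_free Om H ip -> quasi_free Om H' ip' ->
  generating Om H ip f -> generating Om H' ip' g ->
  unitarily_equivalent Om H ip H' ip' ->
  exists Psi : Cn R n -> 'M[R[i]]_m,
    hol_matrix Om Psi /\
    forall z, Om z -> forall S,
      is_modulus Om H ip H' ip' f g z S ->
      is_abs (cip Om H ip f z) (cip Om H ip f z) (Psi z) S.
Proof.
move=> [_ oOm _ _] QF QF' [fH _ fbasis] [gH _ gbasis] [U UU].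
have {}UU : module_unitary Om H ip H' ip' U := UU.
have [W [WW [UW WU]]] := module_unitary_inv QF QF' UU.
have [UH _ _ Uip _] := UU; have WH F : H' F -> H (W F) by case: WW => + _ _ _ _; exact.
pose G i := W (g i).
have GH i : H (G i) by apply: WH.
have UG c : U (comb G c) = comb g c.
  rewrite (module_unitary_comb QF UU)//; congr (comb _ c); apply/funext => i.
  exact: UW.
pose Fm z : 'M[R[i]]_m := \matrix_(i, j) f j z i 0.
pose Gm z : 'M[R[i]]_m := \matrix_(i, j) G j z i 0.
have fc c : H (comb f c) by exact: (quasi_free_comb QF).
have Gc c : H (comb G c) by exact: (quasi_free_comb QF).
have gc c : H' (comb g c) by exact: (quasi_free_comb QF').
(* Coordinates modulo [Rz] can be read off from values at [z]. *)
have Rz_comb z F c : Om z -> Rz Om H ip z (F - comb f c) -> F z = Fm z *m c.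
  move=> hz /(Rz_eval QF hz) h; rewrite -combE; apply/eqP; rewrite -subr_eq0.
  by apply/eqP; rewrite -[RHS]h.
have Fu z : Om z -> Fm z \in unitmx.
  move=> hz; apply: surjective_unitmx => v.
  have [F hF Fv] := quasi_free_const QF v.
  have [c hc] := (fbasis z hz).1 F hF.
  by exists c; rewrite -(Rz_comb z F c hz hc) Fv.
(* Cramer's form of [invmx (Fm z) *m Gm z], suited to differentiation. *)
pose Psi z := ((\det (Fm z))^-1 *: \adj (Fm z)) *m Gm z.
have PsiE z : Om z -> Psi z = invmx (Fm z) *m Gm z.
  by move=> hz; rewrite /Psi /invmx Fu.
(* The coordinates [d] of [comb G c] exist because the [f i] give a basis, and evaluation at [z]
   identifies them as [Psi z *m c]. *)
have PsiP z c : Om z -> Rz Om H ip z (comb G c - comb f (Psi z *m c)).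
  move=> hz; have [d hd] := (fbasis z hz).1 _ (Gc c).
  have := Rz_comb z _ d hz hd; rewrite combE -/(Gm z) => E.
  by rewrite PsiE// -mulmxA E mulKmx ?Fu.
(* The classes of the [G i] span the quotient: [W] transports the spanning property of the [g i]. *)
have Psiu z : Om z -> Psi z \in unitmx.
  move=> hz; apply: surjective_unitmx => v.
  have [c hc] := (gbasis z hz).1 _ (UH _ (fc v)).
  exists c; rewrite PsiE// -mulmxA.
  have : Rz Om H ip z (comb f v - comb G c).
    have := module_unitary_Rz QF' QF WW hc.
    rewrite (module_unitaryB WW)//; last exact: UH.
    by rewrite -UG !WU.
  move=> /(Rz_eval QF hz) /eqP.
  rewrite -[(_ - _) z]/(comb f v z - comb G c z) subr_eq0 !combE => /eqP <-.
  by rewrite mulKmx ?Fu.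
exists Psi; split.
  move=> i j z hz.
  rewrite (_ : (fun _ => _) = fun w => \sum_k ((\det (Fm w))^-1 * \adj (Fm w) i k) * Gm w k j).
    apply: differentiable_sum_seq => k.
    have h1 : differentiable ((fun w => Gm w k j) : Cn R n -> CC R) z.
      rewrite (_ : (fun _ => _) = fun w => G j w k 0).
        exact: (quasi_free_holomorphic QF _ oOm).
      by apply/funext => w; rewrite mxE.
    refine (@differentiableM _ _ _ _ z _ h1).
    apply: differentiable_invmx; first exact: Fu.
    move=> i' j'; rewrite (_ : (fun _ => _) = fun w => f j' w i' 0).
      exact: (quasi_free_holomorphic QF _ oOm).
    by apply/funext => w; rewrite mxE.
  by apply/funext => w; rewrite mxE; apply: eq_bigr => k _; rewrite mxE.
(* The isometry of the quotients in coordinates: the inner product in the basis from [g] is the one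
   in the basis from [f], pulled back by [Psi z]. *)
have cip_Psi z x y : Om z ->
    cip Om H' ip' g z x y = cip Om H ip f z (Psi z *m x) (Psi z *m y).
  move=> hz; rewrite /cip /qip -!UG !(module_unitary_qproj _ QF QF' UU)//.
  have [P1 _ _] := qprojP QF z (Gc x); have [P2 _ _] := qprojP QF z (Gc y).
  by rewrite Uip// !(qproj_mod QF (Gc _) (fc _) (PsiP _ _ hz)).
move=> z hz S [D [Dloc [B [adj pos SB]]]].
have D1 : D = 1%:M.
  have DE (c : 'cV[R[i]]_m) : D *m c = c.
    (* Constant multipliers place this pair in the graph, and independence of the classes of the
       [g i] then forces [D *m c = c]. *)
    have Dl : Delta Om H ip H' ip' f g (comb f c) (comb g c).
      split => // eps e0; exists m, (fun j _ => c j 0), id; split.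
        by move=> j; exact: A_alg_cst.
      have E (h : 'I_m -> Fn R n m) : \sum_(j < m) mulA (fun=> c j 0) (h j) = comb h c.
        by apply: eq_bigr => j _; apply/funext.
      by rewrite !E !subrr (quasi_free_ip00 QF) (quasi_free_ip00 QF') addr0.
    have := Dloc _ _ Dl c; rewrite subrr => /(_ (Rz0 QF z)) h.
    have : Rz Om H' ip' z (comb g (- 1 *: (D *m c) + c)).
      by rewrite comb_linear scaleN1r addrC.
    move=> /(gbasis z hz).2 /eqP; rewrite scaleN1r addrC subr_eq0 => /eqP <-.
    by [].
  apply/matrixP => i j; have := DE (delta_mx j 0).
  move=> /(congr1 (fun v : 'cV_m => v i 0)); rewrite -colE !mxE => ->.
  by rewrite eqxx andbT.
(* As [D] is the identity, [B] is the adjoint of the identity between the two inner products, and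
   [cip_Psi] identifies it with Psi^* Psi. Hence the adjoint of [Psi z] is [B *m invmx (Psi z)], and
   [S *m S = B] is the required identity. *)
exists (B *m invmx (Psi z)); split => //.
  move=> x y; rewrite -mulmxA -adj D1 mul1mx cip_Psi//.
  by rewrite mulmxA mulmxV ?mul1mx// Psiu.
by rewrite SB D1 mulmx1 mulmxKV// Psiu.
Qed.
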